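(* Let $C=75$ and $\alpha=0.01$. Let $0<\delta<1$ and let $2\le K\le N$ and $M\ge1$ be integers. Construct an $M\times N$ matrix $\Phi$ by drawing each of its entries independently from a (real) Gaussian distribution with mean zero and variance $\frac1M$. Then $\Phi$ has $\left(K,\frac{(1-\alpha)\delta}{2C\log K}\right)$-flat restricted orthogonality and $\delta_1\leq\alpha\delta$, and therefore the $(2K,\delta)$-restricted isometry property, with high probability provided $M\geq\frac{33C^2}{\delta^2}K\log^2K\log N$. Here ''with high probability'' means: for every $\eta>0$ there is $N_0$ such that for all integers $N\ge N_0$, all real $\delta$ with $0<\delta<1$, all integers $K$ with $2\le K\le N$, and all integers $M\ge1$ satisfying $M\geq\frac{33C^2}{\delta^2}K\log^2K\log N$, all the stated properties hold simultaneously with probability at least $1-\eta$.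
   Context: $\log$ is the natural logarithm. Let $\varphi_1,\dots,\varphi_N$ denote the columns of $\Phi$. $\Phi$ has $(K,\hat\theta)$-flat restricted orthogonality if $\left|\left\langle\sum_{i\in\mathcal I}\varphi_i,\sum_{j\in\mathcal J}\varphi_j\right\rangle\right|\le\hat\theta(|\mathcal I||\mathcal J|)^{1/2}$ for every disjoint pair of subsets $\mathcal I,\mathcal J\subseteq\{1,\dots,N\}$ with $|\mathcal I|,|\mathcal J|\le K$. $\Phi$ has the $(K,\delta)$-restricted isometry property if $(1-\delta)\|x\|^2\le\|\Phi x\|^2\le(1+\delta)\|x\|^2$ for every vector $x$ with at most $K$ nonzero entries; the smallest such $\delta$ is the restricted isometry constant $\delta_K$. In particular $\delta_1=\max_n\left|\|\varphi_n\|^2-1\right|$. *)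

(* Defs.v *)
From HB Require Import structures.
From mathcomp Require Import all_boot all_order all_algebra.
From mathcomp Require Import all_classical all_reals all_analysis.

Set Implicit Arguments.
Unset Strict Implicit.
Unset Printing Implicit Defensive.
Import Order.TTheory GRing.Theory Num.Theory.
Import numFieldNormedType.Exports.

Local Open Scope classical_set_scope.
Local Open Scope ring_scope.

Definition dotcv (R : realType) (m : nat) (u v : 'cV[R]_m) : R :=
  \sum_(i < m) u i 0 * v i 0.

(* The Euclidean norm; the norm `|u| that MathComp-Analysis puts on matrices
   is the maximum norm. *)
Definition l2norm (R : realType) (m : nat) (u : 'cV[R]_m) : R :=
  Num.sqrt (dotcv u u).

Definition flat_RO (R : realType) (m n : nat) (Phi : 'M[R]_(m, n))
    (K : nat) (theta : R) : Prop :=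
  forall I J : {set 'I_n}, [disjoint I & J]%B ->
    (#|I| <= K)%N -> (#|J| <= K)%N ->
    `|dotcv (\sum_(i in I) col i Phi) (\sum_(j in J) col j Phi)|
      <= theta * Num.sqrt (#|I| * #|J|)%:R.

Definition RIP (R : realType) (m n : nat) (Phi : 'M[R]_(m, n))
    (K : nat) (delta : R) : Prop :=
  forall x : 'cV[R]_n, (#|[pred j | x j 0%R != 0%R]| <= K)%N ->
    (1 - delta) * l2norm x ^+ 2 <= l2norm (Phi *m x) ^+ 2
      <= (1 + delta) * l2norm x ^+ 2.

(* For 0 < K and 0 < n the infimum is attained, hence is the smallest delta;
   [inf] is only meaningful in that case. *)
Definition RIC (R : realType) (m n : nat) (Phi : 'M[R]_(m, n))
    (K : nat) : R :=
  inf [set delta | RIP Phi K delta].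

Definition mutually_independent (d : measure_display) (T : measurableType d)
    (R : realType) (P : probability T R) (I : finType)
    (X : I -> {RV P >-> R}) : Prop :=
  forall (J : {set I}) (A : I -> set R),
    (forall i, i \in J -> measurable (A i)) ->
    P [set w | forall i, i \in J -> A i (X i w)]
      = (\prod_(i in J) P (X i @^-1` A i))%E.

(* [normal_prob] takes the mean and the standard deviation.  Laws are compared
   on measurable sets only, since measures take arbitrary values elsewhere. *)
Definition gaussian_rv (d : measure_display) (T : measurableType d)
    (R : realType) (P : probability T R) (X : {RV P >-> R})
    (mean variance : R) : Prop :=
  forall A : set R, measurable A ->
    distribution P X A = normal_prob mean (Num.sqrt variance) A.

Definition random_matrix (d : measure_display) (T : measurableType d)
    (R : realType) (P : probability T R) (m n : nat)
    (X : 'I_m * 'I_n -> {RV P >-> R}) (w : T) : 'M[R]_(m, n) :=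
  \matrix_(i, j) X (i, j) w.

(* Main.v *)
Require Import Defs.
From HB Require Import structures.
From mathcomp Require Import all_boot all_order all_algebra.
From mathcomp Require Import all_classical all_reals all_analysis.
From mathcomp Require Import measurable_realfun ring lra.
Set Implicit Arguments.
Unset Strict Implicit.
Unset Printing Implicit Defensive.
Import Order.TTheory GRing.Theory Num.Theory.
Import numFieldNormedType.Exports.
Local Open Scope ring_scope.

(** Two facts have to be combined: a deterministic one, that flat restricted
    orthogonality together with almost normalized columns implies restricted
    isometry, and a probabilistic one, that a Gaussian matrix has the first two
    properties.

    Deterministic part. Let theta be the flatness constant.  A functional that is
    at most c * sqrt #|S| on the indicator of every small set S is controlled on a
    nonnegative vector by writing it as a positive combination of indicators of
    its level sets.  The weights that appear are the increments of the square
    root, whose squares are dominated by the harmonic series; Cauchy-Schwarz then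
    gives the bound c * sqrt (H_K) times the Euclidean norm ([flat_functional]),
    with H_K the harmonic number.  Applied in both variables this bounds the bilinear
    form of the Gram matrix on vectors with disjoint supports by a multiple of
    theta * H_K, hence of theta * log K ([flat_bilinear]).  For a single sparse
    vector, the off-diagonal part of the Gram form is four times its average
    over all ways of splitting the support in two ([off_diagonal_average]), so
    that the same bound applies, and the diagonal part is governed by the norms
    of the columns ([flat_RO_RIP]).

    Probabilistic part. By polarization ([flat_RO_of_energy]), flat restricted
    orthogonality follows once the squared norm of Phi b is close to that of b
    for the two vectors b built from each pair of small sets.  For fixed b, this
    squared norm is a multiple of a chi-square variable with M degrees of
    freedom.  Its moment generating function is computed by integrating out the
    entries of the matrix one at a time ([quadratic_mgf]), which uses only that
    each entry is independent of the sigma-algebra generated by the others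
    ([ge0_integral_peel]) and a one-dimensional Gaussian integral
    ([integral_normal_prob_expR_sqr]).  Chernoff's bound gives a deviation
    probability of about 2 exp (- M theta^2 / 4) ([energy_concentration]).  There
    are at most N^(2K) pairs of sets, and the constant 33 is what makes
    M theta^2 / 4 exceed 2 K log N by a small proportion, cubic error term
    included ([flat_exponent]).  The failure probability is then at most
    6 N^(- 1 / 250).

    The restricted isometry property being a consequence of the other two, the
    event of the theorem is a finite conjunction of inequalities between
    polynomials in the entries, and is therefore measurable. *)

(** * Functionals that are flat on indicators *)

Lemma cauchy_schwarz_sum (R : rcfType) (T : finType) (p : pred T) (w x : T -> R) :
  \sum_(i | p i) w i * x i <=
  Num.sqrt (\sum_(i | p i) w i ^+ 2) * Num.sqrt (\sum_(i | p i) x i ^+ 2).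
Proof.
set A := \sum_(i | p i) w i ^+ 2; set B := \sum_(i | p i) x i ^+ 2.
set C := \sum_(i | p i) w i * x i.
have A0 : 0 <= A by apply: sumr_ge0 => i _; exact: sqr_ge0.
have B0 : 0 <= B by apply: sumr_ge0 => i _; exact: sqr_ge0.
have : 0 <= \sum_(i | p i) \sum_(j | p j) (w i * x j - w j * x i) ^+ 2.
  by apply: sumr_ge0 => i _; apply: sumr_ge0 => j _; exact: sqr_ge0.
have -> : \sum_(i | p i) \sum_(j | p j) (w i * x j - w j * x i) ^+ 2 =
    2 * (A * B - C ^+ 2).
  transitivity (\sum_(i | p i) (w i ^+ 2 * B + x i ^+ 2 * A - 2 * (w i * x i) * C)).
    apply: eq_bigr => i _.
    rewrite /A /B /C !mulr_sumr -big_split/= -sumrB; apply: eq_bigr => j _; ring.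
  rewrite sumrB big_split/= -!mulr_suml -mulr_sumr -/A -/B -/C; ring.
rewrite pmulr_rge0// subr_ge0 => CAB.
apply: le_trans (ler_norm _) _; rewrite -sqrtr_sqr -sqrtrM//.
exact: ler_wsqrtr.
Qed.

Definition harmonic_number (R : numFieldType) (n : nat) : R := \sum_(k < n) k.+1%:R^-1.

Lemma harmonic_numberS (R : numFieldType) n :
  harmonic_number R n.+1 = harmonic_number R n + n.+1%:R^-1.
Proof. by rewrite /harmonic_number big_ord_recr. Qed.

Lemma harmonic_number_ge0 (R : numFieldType) n : 0 <= harmonic_number R n.
Proof. by apply: sumr_ge0 => i _; rewrite invr_ge0. Qed.

Lemma le_harmonic_number (R : numFieldType) (m n : nat) : (m <= n)%N ->
  harmonic_number R m <= harmonic_number R n.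
Proof.
move=> /subnK <-; elim: (n - m)%N => // k IH.
by apply: le_trans IH _; rewrite addSn harmonic_numberS lerDl invr_ge0.
Qed.

Lemma harmonic_number_le_ln (R : realType) n : (0 < n)%N ->
  harmonic_number R n <= 1 + ln (n%:R : R).
Proof.
elim: n => // -[_ _|n IH _].
  by rewrite /harmonic_number big_ord1 ln1 invr1 addr0.
rewrite harmonic_numberS; apply: le_trans (lerD (IH _) (lexx _)) _ => //.
rewrite -addrA lerD2l -lerBrDl.
have n1 : (0 : R) < n.+1%:R by rewrite ltr0n.
have n2 : (0 : R) < n.+2%:R by rewrite ltr0n.
rewrite -lerN2 opprB -ln_div ?posrE//.
have -> : n.+1%:R / n.+2%:R = 1 + (- n.+2%:R^-1) :> R.
  move: n2; rewrite -(natr1 n.+1); move: (n.+1%:R : R) => y y0.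
  by field; rewrite gt_eqF.
apply: le_ln1Dx; rewrite ltrN2 invf_lt1// ltr1n//.
Qed.

(** The increment is the inverse of sqrt n.+1 + sqrt n. *)
Lemma sqrt_increment_sqr (R : rcfType) n :
  (Num.sqrt n.+1%:R - Num.sqrt n%:R) ^+ 2 <= (n.+1%:R^-1 : R).
Proof.
set a := Num.sqrt n.+1%:R; set b := Num.sqrt n%:R.
have a2 : a ^+ 2 = n.+1%:R by rewrite sqr_sqrtr.
have b2 : b ^+ 2 = n%:R by rewrite sqr_sqrtr.
have ab1 : a ^+ 2 - b ^+ 2 = 1 by rewrite a2 b2 -natr1; ring.
have b0 : 0 <= b by exact: sqrtr_ge0.
have ba : b <= a by apply: ler_wsqrtr; rewrite ler_nat.
have a0 : 0 < a by rewrite sqrtr_gt0 ltr0n.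
rewrite -a2 -[leRHS]mul1r ler_pdivlMr ?exprn_gt0//.
rewrite -exprMn -[leRHS](expr1n _ 2) ler_sqr ?nnegrE ?ler01//; last first.
  by rewrite mulr_ge0 ?subr_ge0// ltW.
nra.
Qed.

Section flat_functional.
Context (R : realType) (T : finType).
Implicit Types (S U : {set T}) (f x w : T -> R).

Definition l2on x S : R := Num.sqrt (\sum_(i in S) x i ^+ 2).

Lemma l2on_ge0 x S : 0 <= l2on x S. Proof. exact: sqrtr_ge0. Qed.

Lemma sqr_l2on x S : l2on x S ^+ 2 = \sum_(i in S) x i ^+ 2.
Proof. by rewrite sqr_sqrtr// sumr_ge0// => i _; exact: sqr_ge0. Qed.

(** Subtracting the least value [x k] splits [x] into [x k] times the indicator
    of [S] and a nonnegative vector supported on [S :\ k], so that [k] receives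
    the weight sqrt #|S| - sqrt #|S :\ k|.  The weights are the increments of the
    square root arranged along the decreasing order of [x]; recording only their
    sum and their sum of squares makes the induction possible without sorting
    the entries. *)
Lemma flat_weights f (c : R) S x :
  (forall i, i \in S -> 0 <= x i) ->
  (forall S', S' \subset S -> \sum_(i in S') f i <= c * Num.sqrt #|S'|%:R) ->
  exists w, [/\ \sum_(i in S) w i = Num.sqrt #|S|%:R,
    \sum_(i in S) w i ^+ 2 <= harmonic_number R #|S| &
    \sum_(i in S) f i * x i <= c * \sum_(i in S) w i * x i].
Proof.
have [n] := ubnP #|S|; elim: n => // n IHn in S x *.
have [->|[k0 k0S]] := set_0Vmem S.
  move=> _ _ _; exists (fun=> 0); rewrite !big_set0 cards0 sqrtr0 mulr0.
  by rewrite harmonic_number_ge0.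
move=> ltSn x0 hf.
case: (@arg_minP _ _ _ k0 (mem S) x k0S) => k kS' kmin.
have kS : k \in S := kS'.
pose S' := S :\ k.
have cS : #|S| = #|S'|.+1 by rewrite (cardsD1 k) kS.
have S'S : S' \subset S by exact: subsetDl.
have [|||w [w1 w2 w3]] := IHn S' (fun i => x i - x k).
- by rewrite -ltnS -cS.
- by move=> i; rewrite !inE => /andP[_ iS]; rewrite subr_ge0; exact: kmin.
- by move=> S'' sub; apply: hf; exact: fintype.subset_trans sub S'S.
pose u i := if i == k then Num.sqrt #|S|%:R - Num.sqrt #|S'|%:R else w i.
have uS' i : i \in S' -> u i = w i.
  by rewrite /u !inE; case: eqP.
have bigS (F : T -> R) : \sum_(i in S) F i = F k + \sum_(i in S') F i.
  by rewrite (big_setD1 k).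
have uk : u k = Num.sqrt #|S|%:R - Num.sqrt #|S'|%:R by rewrite /u eqxx.
exists u; rewrite !bigS uk; split.
- by rewrite (eq_bigr w)// w1 subrK.
- rewrite (eq_bigr (fun i => w i ^+ 2)); last by move=> i iS'; rewrite uS'.
  by rewrite {2}cS harmonic_numberS [leLHS]addrC lerD// cS; exact: sqrt_increment_sqr.
rewrite [X in c * (_ + X)](eq_bigr (fun i => w i * x i)); last first.
  by move=> i iS'; rewrite uS'.
have hS : x k * (f k + \sum_(i in S') f i) <= x k * (c * Num.sqrt #|S|%:R).
  by rewrite ler_wpM2l ?x0// -bigS; exact: hf.
have e1 : \sum_(i in S') f i * (x i - x k) =
    \sum_(i in S') f i * x i - x k * \sum_(i in S') f i.
  by rewrite mulr_sumr -sumrB; apply: eq_bigr => i _; ring.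
have e2 : \sum_(i in S') w i * (x i - x k) =
    \sum_(i in S') w i * x i - x k * \sum_(i in S') w i.
  by rewrite mulr_sumr -sumrB; apply: eq_bigr => i _; ring.
move: w3; rewrite e1 e2 w1; move: hS; lra.
Qed.

Lemma flat_functional_nonneg f (c : R) S x : 0 <= c ->
  (forall i, i \in S -> 0 <= x i) ->
  (forall S', S' \subset S -> \sum_(i in S') f i <= c * Num.sqrt #|S'|%:R) ->
  \sum_(i in S) f i * x i <= c * Num.sqrt (harmonic_number R #|S|) * l2on x S.
Proof.
move=> c0 x0 /(flat_weights x0)[w [_ w2 w3]].
apply: le_trans w3 _; rewrite -mulrA ler_wpM2l//.
apply: le_trans (cauchy_schwarz_sum _ _ _) _.
by rewrite ler_wpM2r ?l2on_ge0// ler_wsqrtr.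
Qed.

(** Gluing costs a factor sqrt 2 because p + q <= sqrt 2 * sqrt (p^2 + q^2). *)
Lemma split_functional f (a : R) S1 S2 x : 0 <= a -> [disjoint S1 & S2] ->
  `|\sum_(i in S1) f i * x i| <= a * l2on x S1 ->
  `|\sum_(i in S2) f i * x i| <= a * l2on x S2 ->
  `|\sum_(i in S1 :|: S2) f i * x i| <= a * Num.sqrt 2 * l2on x (S1 :|: S2).
Proof.
move=> a0 dS h1 h2.
have sumU (F : T -> R) : \sum_(i in S1 :|: S2) F i =
    \sum_(i in S1) F i + \sum_(i in S2) F i.
  by rewrite -bigU//; apply: eq_bigl => i; rewrite !inE.
have -> : l2on x (S1 :|: S2) = Num.sqrt (l2on x S1 ^+ 2 + l2on x S2 ^+ 2).
  by rewrite !sqr_l2on /l2on sumU.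
rewrite sumU; apply: le_trans (ler_normD _ _) _.
apply: le_trans (lerD h1 h2) _; rewrite -mulrDr -mulrA ler_wpM2l//.
set p := l2on x S1; set q := l2on x S2.
rewrite -sqrtrM// -[leLHS]ger0_norm ?addr_ge0 ?l2on_ge0// -sqrtr_sqr.
by apply: ler_wsqrtr; have := sqr_ge0 (p - q); lra.
Qed.

Lemma subset_split K S : (#|S| <= K + K)%N ->
  exists S1 S2, [/\ S = S1 :|: S2, [disjoint S1 & S2], (#|S1| <= K)%N &
    (#|S2| <= K)%N].
Proof.
move=> cS; pose S1 : {set T} := [set i in take K (enum S)]%SET.
have cS1 : #|S1| = size (take K (enum S)).
  by rewrite cardsE; apply/card_uniqP; rewrite take_uniq// enum_uniq.
have S1S : S1 \subset S.
  by apply/fintype.subsetP => i; rewrite inE => /mem_take; rewrite mem_enum.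
exists S1, (S :\: S1); split.
- by rewrite -{1}(finset.setID S S1) (finset.setIidPr S1S).
- by rewrite -setI_eq0 finset.setIDA finset.setIC finset.setDIl finset.setDv finset.setI0.
- by rewrite cS1 size_take_min geq_minl.
- rewrite cardsD (finset.setIidPr S1S) cS1 size_take_min -cardE.
  by rewrite leq_subLR /minn; case: ltnP => // _; rewrite leq_addr.
Qed.

(** The factor 2 comes from gluing twice: the nonnegative and the negative
    entries of [x], then the two halves of [U]. *)
Lemma flat_functional f (c : R) U x K : 0 <= c -> (#|U| <= K + K)%N ->
  (forall S, S \subset U -> (#|S| <= K)%N ->
    `|\sum_(i in S) f i| <= c * Num.sqrt #|S|%:R) ->
  `|\sum_(i in U) f i * x i| <= 2 * c * Num.sqrt (harmonic_number R K) * l2on x U.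
Proof.
move=> c0 cU hf; set h := Num.sqrt (harmonic_number R K).
have ch0 : 0 <= c * h by rewrite mulr_ge0 ?sqrtr_ge0.
have nonneg y S : (forall i, i \in S -> 0 <= y i) ->
    S \subset U -> (#|S| <= K)%N ->
    `|\sum_(i in S) f i * y i| <= c * h * l2on y S.
  move=> y0 SU cS.
  have hS S' : S' \subset S -> `|\sum_(i in S') f i| <= c * Num.sqrt #|S'|%:R.
    move=> S'S; apply: hf; first exact: fintype.subset_trans S'S SU.
    exact: leq_trans (subset_leq_card S'S) cS.
  have mono : c * Num.sqrt (harmonic_number R #|S|) * l2on y S <= c * h * l2on y S.
    rewrite ler_wpM2r ?l2on_ge0// ler_wpM2l//; apply: ler_wsqrtr.
    exact: le_harmonic_number.
  rewrite ler_norml; apply/andP; split; last first.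
    apply: le_trans mono; apply: flat_functional_nonneg => // S' /hS.
    exact: le_trans (ler_norm _).
  rewrite lerNl -sumrN; under eq_bigr do rewrite -mulNr.
  apply: le_trans mono; apply: flat_functional_nonneg => // S' /hS.
  by rewrite sumrN -normrN; exact: le_trans (ler_norm _).
have small S : S \subset U -> (#|S| <= K)%N ->
    `|\sum_(i in S) f i * x i| <= c * h * Num.sqrt 2 * l2on x S.
  move=> SU cS; pose Sp := [set i in S | 0 <= x i]%SET.
  pose Sn := [set i in S | x i < 0]%SET.
  have SpS : Sp \subset S by apply/fintype.subsetP => i; rewrite inE => /andP[].
  have SnS : Sn \subset S by apply/fintype.subsetP => i; rewrite inE => /andP[].
  have SE : S = Sp :|: Sn.
    by apply/setP => i; rewrite !inE -andb_orr; case: leP; rewrite andbT.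
  have dS : [disjoint Sp & Sn].
    rewrite -setI_eq0; apply/eqP/setP => i; rewrite !inE.
    by case: leP; rewrite ?andbF.
  rewrite SE; apply: split_functional => //.
    apply: nonneg => [i||]; first by rewrite inE => /andP[].
      exact: fintype.subset_trans SpS SU.
    exact: leq_trans (subset_leq_card SpS) cS.
  have -> : l2on x Sn = l2on (fun i => - x i) Sn.
    by congr Num.sqrt; apply: eq_bigr => i _; rewrite sqrrN.
  have -> : `|\sum_(i in Sn) f i * x i| = `|\sum_(i in Sn) f i * - x i|.
    by rewrite -normrN -sumrN; under eq_bigr do rewrite -mulrN.
  apply: nonneg => [i||].
  - by rewrite inE => /andP[_ /ltW]; rewrite oppr_ge0.
  - exact: fintype.subset_trans SnS SU.
  - exact: leq_trans (subset_leq_card SnS) cS.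
have [S1 [S2 [UE dS c1 c2]]] := subset_split cU.
have s2 : Num.sqrt 2 * Num.sqrt 2 = 2 :> R by rewrite -expr2 sqr_sqrtr.
have -> : 2 * c * h * l2on x U = c * h * Num.sqrt 2 * Num.sqrt 2 * l2on x U.
  by rewrite -[X in _ = X * _]mulrA s2; ring.
rewrite [in leLHS]UE [in leRHS]UE; apply: split_functional => //.
- by rewrite mulr_ge0 ?sqrtr_ge0.
- by apply: small => //; rewrite UE finset.subsetUl.
- by apply: small => //; rewrite UE finset.subsetUr.
Qed.

(** With [J] fixed, the row sums over [J] form a flat functional in the first
    variable, with constant th * sqrt #|J|.  The bound this gives has the factor
    sqrt #|J| again, which says that summing against [x] leaves a flat functional
    in the second variable. *)
Lemma flat_bilinear (b : T -> T -> R) (th : R) (U V : {set T}) x y K :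
  0 <= th -> (#|U| <= K + K)%N -> (#|V| <= K + K)%N ->
  (forall I J : {set T}, I \subset U -> J \subset V -> (#|I| <= K)%N -> (#|J| <= K)%N ->
    `|\sum_(i in I) \sum_(j in J) b i j| <= th * Num.sqrt (#|I| * #|J|)%:R) ->
  `|\sum_(i in U) \sum_(j in V) b i j * x i * y j| <=
    4 * th * harmonic_number R K * l2on x U * l2on y V.
Proof.
move=> th0 cU cV hb; set h := Num.sqrt (harmonic_number R K).
have hh : h * h = harmonic_number R K by rewrite -expr2 sqr_sqrtr// harmonic_number_ge0.
have -> : \sum_(i in U) \sum_(j in V) b i j * x i * y j =
    \sum_(j in V) (\sum_(i in U) b i j * x i) * y j.
  by rewrite exchange_big/=; apply: eq_bigr => j _; rewrite mulr_suml.
have -> : 4 * th * harmonic_number R K * l2on x U * l2on y V =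
    2 * (2 * th * h * l2on x U) * h * l2on y V by rewrite -hh; ring.
apply: flat_functional => // [|J JV cJ].
  by rewrite !mulr_ge0 ?sqrtr_ge0.
rewrite exchange_big/=; under eq_bigr do rewrite -mulr_suml.
have -> : 2 * th * h * l2on x U * Num.sqrt #|J|%:R =
  2 * (th * Num.sqrt #|J|%:R) * h * l2on x U by ring.
apply: flat_functional => // [|I IU cI]; first by rewrite mulr_ge0 ?sqrtr_ge0.
apply: le_trans (hb I J IU JV cI cJ) _.
by rewrite natrM sqrtrM// -mulrA [Num.sqrt #|I|%:R * _]mulrC.
Qed.

(** These sets are the [i |: B] with [B] avoiding both points. *)
Lemma card_separating (i j : T) : i != j ->
  (4 * #|[set A : {set T} | (i \in A) && (j \notin A)]| = #|{set T}|)%N.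
Proof.
move=> ij; pose D := ~: [set i; j].
have -> : [set A : {set T} | (i \in A) && (j \notin A)] =
    [set i |: B | B in powerset D].
  apply/setP => A; rewrite inE; apply/idP/imsetP.
    move=> /andP[iA jA]; exists (A :\ i); last by rewrite finset.setD1K.
    rewrite inE; apply/fintype.subsetP => k; rewrite !inE => /andP[ki kA].
    by rewrite negb_or ki/=; apply: contraNneq jA => <-.
  move=> [B]; rewrite inE => BD ->; rewrite !inE eqxx/= negb_or eq_sym ij/=.
  by apply/negP => /(fintype.subsetP BD); rewrite !inE eqxx orbT.
rewrite card_in_imset; last first.
  move=> B B'; rewrite !inE => BD B'D /(congr1 (fun A => A :\ i)).
  rewrite !setU1K//; apply/negP => /(fintype.subsetP _).
    by move=> /(_ _ B'D); rewrite !inE eqxx.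
  by move=> /(_ _ BD); rewrite !inE eqxx.
rewrite card_powerset -[RHS]cardsT -finset.powersetT card_powerset cardsT.
by rewrite -(cardsC [set i; j]) cards2 ij expnD.
Qed.

(** A uniformly random set [A] contains a given [i] and misses a given [j] other
    than [i] with probability 1/4. *)
Lemma off_diagonal_average (a : T -> T -> R) :
  #|{set T}|%:R * (\sum_i \sum_(j | j != i) a i j) =
  4 * \sum_(A : {set T}) \sum_(i in A) \sum_(j in ~: A) a i j.
Proof.
transitivity (4 * \sum_i \sum_(j | j != i)
    \sum_(A : {set T} | (i \in A) && (j \notin A)) a i j).
  rewrite !mulr_sumr; apply: eq_bigr => i _; rewrite !mulr_sumr.
  apply: eq_bigr => j ji; rewrite sumr_const -[X in 4 * X]mulr_natl mulrA -natrM.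
  congr (_%:R * _); rewrite -(card_separating (i := i) (j := j)) 1?eq_sym//.
  by congr (4 * _)%N; apply: eq_card => A; rewrite inE.
congr (4 * _); under eq_bigr do under eq_bigr do rewrite big_mkcond.
under eq_bigr do rewrite big_mkcond.
under [RHS]eq_bigr do rewrite big_mkcond.
rewrite [RHS]exchange_big/=; apply: eq_bigr => i _.
have -> : \sum_(A : {set T}) (if i \in A then \sum_(j in ~: A) a i j else 0) =
  \sum_(A : {set T}) \sum_j (if (i \in A) && (j \notin A) then a i j else 0).
  apply: eq_bigr => A _; case: ifP => iA; last by rewrite big1.
  by rewrite big_mkcond/=; apply: eq_bigr => j _; rewrite inE.
rewrite exchange_big/=; apply: eq_bigr => j _; case: eqP => // ->.
by rewrite big1// => A _; case: (i \in A).
Qed.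

End flat_functional.

(** * From flat restricted orthogonality to restricted isometry *)

Section deterministic.
Context (R : realType) (m n : nat) (Phi : 'M[R]_(m, n)).

Definition gram (i j : 'I_n) : R := dotcv (col i Phi) (col j Phi).

Lemma sqr_l2norm k (u : 'cV[R]_k) : l2norm u ^+ 2 = \sum_i u i 0 ^+ 2.
Proof.
rewrite /l2norm /dotcv sqr_sqrtr; last by apply: sumr_ge0 => i _; exact: sqr_ge0.
by apply: eq_bigr => i _; rewrite expr2.
Qed.

Lemma dotcv_sums (I J : {set 'I_n}) :
  dotcv (\sum_(i in I) col i Phi) (\sum_(j in J) col j Phi) =
  \sum_(i in I) \sum_(j in J) gram i j.
Proof.
rewrite /dotcv /gram /dotcv.
under eq_bigr do rewrite !summxE mulr_suml.
rewrite exchange_big/=; apply: eq_bigr => i _.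
rewrite exchange_big/=; apply: eq_bigr => r _; exact: mulr_sumr.
Qed.

Lemma sqr_l2norm_mulmx (x : 'cV[R]_n) : l2norm (Phi *m x) ^+ 2 =
  \sum_i gram i i * x i 0 ^+ 2 +
  \sum_i \sum_(j | j != i) gram i j * x i 0 * x j 0.
Proof.
rewrite -big_split/= sqr_l2norm.
transitivity (\sum_i \sum_j gram i j * x i 0 * x j 0).
  under eq_bigr do rewrite mxE expr2 mulr_suml.
  rewrite exchange_big/=; apply: eq_bigr => i _.
  under eq_bigr do rewrite mulr_sumr.
  rewrite exchange_big/=; apply: eq_bigr => j _.
  rewrite /gram /dotcv !mulr_suml; apply: eq_bigr => r _.
  by rewrite !mxE; ring.
by apply: eq_bigr => i _; rewrite (bigD1 i)//= -mulrA expr2.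
Qed.

(** Decoupling: averaging over [A] replaces a sum where both indices range over
    the support of [x] by sums over two disjoint sets, which is the situation of
    [flat_bilinear].  The constant is 4 from the average times 4 from the
    bilinear bound, halved by 2 u v <= u^2 + v^2. *)
Lemma off_diagonal_bound (K : nat) (th : R) (x : 'cV[R]_n) : 0 <= th ->
  flat_RO Phi K th -> (#|[pred j | x j 0%R != 0%R]| <= 2 * K)%N ->
  `|\sum_i \sum_(j | j != i) gram i j * x i 0 * x j 0| <=
    8 * th * harmonic_number R K * l2norm x ^+ 2.
Proof.
move=> th0 hflat cx; set Q := \sum_i _; set H := harmonic_number R K.
have H0 : 0 <= H by exact: harmonic_number_ge0.
pose S : {set 'I_n} := [set j | x j 0 != 0]%SET.
pose y i := x i 0.
have cS : (#|S| <= K + K)%N by rewrite addnn -mul2n cardsE.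
have nE : l2norm x ^+ 2 = \sum_(i in S) y i ^+ 2.
  rewrite sqr_l2norm [RHS]big_mkcond; apply: eq_bigr => i _.
  by rewrite inE; case: eqP => //= ->; rewrite expr0n.
have hA (A : {set 'I_n}) :
    `|\sum_(i in A) \sum_(j in ~: A) gram i j * y i * y j| <=
    2 * th * H * l2norm x ^+ 2.
  pose U := A :&: S; pose V := ~: A :&: S.
  have sumS (B : {set 'I_n}) (F : 'I_n -> R) :
      \sum_(i in B) F i * y i = \sum_(i in B :&: S) F i * y i.
    rewrite big_mkcond [RHS]big_mkcond; apply: eq_bigr => i _; rewrite !inE.
    case: (i \in B) => //=; case: eqP => //= h; by rewrite /y h mulr0.
  have -> : \sum_(i in A) \sum_(j in ~: A) gram i j * y i * y j =
      \sum_(i in U) \sum_(j in V) gram i j * y i * y j.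
    transitivity (\sum_(i in A) (\sum_(j in V) gram i j * y j) * y i).
      apply: eq_bigr => i _; rewrite sumS mulr_suml.
      by apply: eq_bigr => j _; ring.
    rewrite sumS; apply: eq_bigr => i _; rewrite mulr_suml.
    by apply: eq_bigr => j _; ring.
  have US : U \subset S by exact: finset.subsetIr.
  have VS : V \subset S by exact: finset.subsetIr.
  have dUV : [disjoint U & V].
    rewrite -setI_eq0; apply/eqP/setP => i; rewrite !inE.
    by case: (i \in A); rewrite ?andbF.
  have cU : (#|U| <= K + K)%N by exact: leq_trans (subset_leq_card US) cS.
  have cV : (#|V| <= K + K)%N by exact: leq_trans (subset_leq_card VS) cS.
  apply: le_trans (flat_bilinear y y th0 cU cV _) _.
    move=> I J IU JV cI cJ; rewrite -dotcv_sums; apply: hflat => //.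
    exact: disjointWl IU (disjointWr JV dUV).
  have -> : l2norm x ^+ 2 = l2on y U ^+ 2 + l2on y V ^+ 2.
    rewrite nE !sqr_l2on (finset.big_setID A)/=; congr (_ + _); apply: eq_bigl => i.
      by rewrite !inE andbC.
    by rewrite !inE.
  set u := l2on y U; set v := l2on y V.
  have -> : 4 * th * harmonic_number R K * u * v = 2 * th * H * (2 * (u * v)).
    by rewrite /H; ring.
  rewrite ler_wpM2l ?mulr_ge0//.
  have := sqr_ge0 (u - v); nra.
have c0 : 0 < #|{set 'I_n}|%:R :> R.
  by rewrite ltr0n; apply/card_gt0P; exists finset.set0.
rewrite -(ler_pM2l c0) -[X in X * `|_|]ger0_norm ?ler0n// -normrM.
rewrite /Q off_diagonal_average normrM (ger0_norm (ler0n _ _)).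
have -> : #|{set 'I_n}|%:R * (8 * th * H * l2norm x ^+ 2) =
  4 * (2 * th * H * l2norm x ^+ 2 *+ #|{set 'I_n}|).
  by rewrite -[X in _ = 4 * X]mulr_natl; ring.
rewrite ler_wpM2l//; apply: le_trans (ler_norm_sum _ _ _) _.
by rewrite -sumr_const; apply: ler_sum => A _; exact: hA.
Qed.

Lemma flat_RO_RIP (K : nat) (th a : R) : 0 <= th -> flat_RO Phi K th ->
  (forall j, `|gram j j - 1| <= a) ->
  RIP Phi (2 * K) (8 * th * harmonic_number R K + a).
Proof.
move=> th0 hflat hdiag x cx.
rewrite sqr_l2norm_mulmx; set Q := \sum_i \sum_(j | _) _.
have : `|Q| <= 8 * th * harmonic_number R K * l2norm x ^+ 2.
  exact: off_diagonal_bound.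
have : `|\sum_i (gram i i - 1) * x i 0 ^+ 2| <= a * l2norm x ^+ 2.
  apply: le_trans (ler_norm_sum _ _ _) _; rewrite sqr_l2norm mulr_sumr.
  apply: ler_sum => i _; rewrite normrM [X in _ * X]ger0_norm ?sqr_ge0//.
  by rewrite ler_wpM2r ?sqr_ge0.
have -> : \sum_i (gram i i - 1) * x i 0 ^+ 2 =
    \sum_i gram i i * x i 0 ^+ 2 - l2norm x ^+ 2.
  by rewrite sqr_l2norm -sumrB; apply: eq_bigr => i _; ring.
rewrite !ler_norml => /andP[h1 h2] /andP[h3 h4].
by apply/andP; split; lra.
Qed.

(** A vector with at most one nonzero entry has no off-diagonal contribution. *)
Lemma RIP1P (c : R) : RIP Phi 1 c <-> forall j, `|gram j j - 1| <= c.
Proof.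
split=> [h j|h x cx].
  have := h (delta_mx j 0).
  have cj : (#|[pred i | (delta_mx j 0%R : 'cV[R]_n) i 0%R != 0%R]| <= 1)%N.
    rewrite -[leqRHS](card1 j); apply: subset_leq_card; apply/fintype.subsetP => i.
    by rewrite !inE mxE eqxx andbT; case: (i == j); rewrite ?eqxx.
  move=> /(_ cj); rewrite -colE.
  have -> : l2norm (delta_mx j 0 : 'cV[R]_n) ^+ 2 = 1.
    rewrite sqr_l2norm (bigD1 j)//= mxE !eqxx expr1n big1 ?addr0// => i ij.
    by rewrite mxE (negbTE ij) expr0n.
  have -> : l2norm (col j Phi) ^+ 2 = gram j j.
    by rewrite sqr_l2norm; apply: eq_bigr => i _; rewrite expr2.
  by rewrite ler_norml => /andP[h1 h2]; apply/andP; split; lra.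
have off0 : \sum_i \sum_(j | j != i) gram i j * x i 0 * x j 0 = 0.
  apply: big1 => i _; rewrite big1// => j ji.
  have [->|xi] := eqVneq (x i 0) 0; first by rewrite mulr0 mul0r.
  have [->|xj] := eqVneq (x j 0) 0; first by rewrite mulr0.
  have := subset_leq_card (_ : [set i; j]%SET \subset [pred k | x k 0 != 0]).
  rewrite cards2 eq_sym ji => /(_ _)/leq_trans/(_ cx); move=> abs.
  suff : (2 <= 1)%N by [].
  apply: abs; apply/fintype.subsetP => k; rewrite !inE.
  by case/orP => /eqP ->.
rewrite sqr_l2norm_mulmx off0 addr0 sqr_l2norm !mulr_sumr.
apply/andP; split; apply: ler_sum => i _.
  by rewrite ler_wpM2r ?sqr_ge0//; have := h i; rewrite ler_norml; lra.
by rewrite ler_wpM2r ?sqr_ge0//; have := h i; rewrite ler_norml; lra.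
Qed.

(** This turns a condition on an infimum over an uncountable set into one
    condition for each column, hence into an event. *)
Lemma RIC1_le (c : R) : (0 < n)%N ->
  (RIC Phi 1 <= c) <-> (forall j, `|gram j j - 1| <= c).
Proof.
move=> n0; pose j0 := Ordinal n0; set E := [set delta | RIP Phi 1 delta]%classic.
have E0 : (E !=set0)%classic.
  exists (\sum_j `|gram j j - 1|); apply/RIP1P => j.
  by rewrite (bigD1 j)//= lerDl sumr_ge0.
have lbE j : lbound E `|gram j j - 1| by move=> c' /RIP1P; exact.
split=> [h j|h].
  by apply: le_trans h; exact: lb_le_inf.
apply: ge_inf; last by apply/RIP1P.
by exists `|gram j0 j0 - 1|.
Qed.

End deterministic.

(** * Polarization *)

Section polarization.
Context (R : realType) (m n : nat) (Phi : 'M[R]_(m, n)).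

(** The squared Euclidean norm of the product of [Phi] and the vector [b]. *)
Definition mx_energy (b : 'I_n -> R) : R := \sum_r (\sum_j b j * Phi r j) ^+ 2.

Lemma mx_energy_delta j : mx_energy (fun k => (k == j)%:R) = gram Phi j j.
Proof.
rewrite /gram /dotcv; apply: eq_bigr => r _; rewrite (bigD1 j)//= eqxx mul1r.
rewrite big1 ?addr0 ?mxE ?expr2// => k /negbTE ->; exact: mul0r.
Qed.
End polarization.

(** The sum or the difference, according to the sign [u.2], of the indicators of
    the two sets; each is multiplied by the norm of the other one, which gives
    them equal norms without dividing. *)
Definition polar (R : rcfType) (T : finType) (u : {set T} * {set T} * bool) (j : T) : R :=
  Num.sqrt #|u.1.2|%:R * (j \in u.1.1)%:R +
  (-1) ^+ u.2 * (Num.sqrt #|u.1.1|%:R * (j \in u.1.2)%:R).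

Lemma sum_sqr_polar (R : rcfType) (T : finType) (I J : {set T}) (s : bool) :
  [disjoint I & J]%B ->
  \sum_j polar R (I, J, s) j ^+ 2 = 2 * #|I|%:R * #|J|%:R.
Proof.
move=> dIJ.
transitivity (\sum_j (#|J|%:R * (j \in I)%:R + #|I|%:R * (j \in J)%:R : R)).
  apply: eq_bigr => j _; rewrite /polar/=.
  have := disjointFr dIJ (x := j); case: (j \in I) => [/(_ isT) ->|_].
    by rewrite !mulr1 !mulr0 !addr0 sqr_sqrtr.
  by rewrite mulr0 add0r mulr0 add0r !exprMn sqrr_sign mul1r sqr_sqrtr//;
    case: (j \in J); rewrite ?expr1n ?expr0n.
rewrite big_split/= -!mulr_sumr.
have cE (A : {set T}) : \sum_j ((j \in A)%:R : R) = #|A|%:R.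
  by rewrite -sum1_card natr_sum [RHS]big_mkcond; apply: eq_bigr => j _; case: (j \in A).
by rewrite !cE; ring.
Qed.

(** The energies of the sum and of the difference differ by
    4 sqrt (#|I| #|J|) times the inner product, while both are within
    2 th #|I| #|J| of the same value. *)
Lemma flat_RO_of_energy (R : realType) (m n : nat) (Phi : 'M[R]_(m, n)) K (th : R) :
  (forall (I J : {set 'I_n}) s, [disjoint I & J]%B ->
    (0 < #|I| <= K)%N -> (0 < #|J| <= K)%N ->
    `|mx_energy Phi (polar R (I, J, s)) - \sum_j polar R (I, J, s) j ^+ 2| <=
      th * \sum_j polar R (I, J, s) j ^+ 2) ->
  flat_RO Phi K th.
Proof.
move=> h I J dIJ cI cJ.
have [I0|I0] := posnP #|I|.
  by rewrite I0 mul0n sqrtr0 mulr0 (cards0_eq I0) dotcv_sums big_set0 normr0.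
have [J0|J0] := posnP #|J|.
  rewrite J0 muln0 sqrtr0 mulr0 (cards0_eq J0) dotcv_sums big1 ?normr0// => i _.
  by rewrite big_set0.
have := h I J true dIJ; have := h I J false dIJ.
rewrite !sum_sqr_polar// I0 J0 cI cJ => /(_ isT isT) + /(_ isT isT).
set p := Num.sqrt #|J|%:R : R; set q := Num.sqrt #|I|%:R : R.
have p2 : p ^+ 2 = #|J|%:R by rewrite sqr_sqrtr.
have q2 : q ^+ 2 = #|I|%:R by rewrite sqr_sqrtr.
have p0 : 0 < p by rewrite sqrtr_gt0 ltr0n.
have q0 : 0 < q by rewrite sqrtr_gt0 ltr0n.
set dt := dotcv _ _.
have : mx_energy Phi (polar R (I, J, false)) - mx_energy Phi (polar R (I, J, true)) =
    4 * (p * q) * dt.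
  pose U r := \sum_(i in I) Phi r i; pose V r := \sum_(i in J) Phi r i.
  have lin s r : \sum_j polar R (I, J, s) j * Phi r j = p * U r + (-1) ^+ s * (q * V r).
    rewrite /U /V !mulr_sumr [in RHS]big_mkcond [X in _ + X]big_mkcond -big_split/=.
    apply: eq_bigr => j _; rewrite /polar/= -/p -/q.
    by case: (j \in I); case: (j \in J); rewrite ?mulr1 ?mulr0 ?addr0 ?add0r ?mul0r//; ring.
  rewrite /mx_energy -sumrB /dt /dotcv mulr_sumr; apply: eq_bigr => r _.
  rewrite !lin/= expr0 expr1 !summxE.
  have -> : \sum_(i in I) (col i Phi) r 0 = U r by apply: eq_bigr => i _; rewrite mxE.
  have -> : \sum_(i in J) (col i Phi) r 0 = V r by apply: eq_bigr => i _; rewrite mxE.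
  by ring.
rewrite natrM sqrtrM// -/p -/q -p2 -q2 => e.
rewrite !ler_norml => /andP[h1 h2] /andP[h3 h4].
have pq0 : 0 < p * q by rewrite mulr_gt0.
have hu : (p * q) * dt <= (p * q) * (th * (q * p)).
  by move: e h1 h2 h3 h4; clear; nra.
have hl : (p * q) * (- (th * (q * p))) <= (p * q) * dt.
  by move: e h1 h2 h3 h4; clear; nra.
by rewrite -(ler_pM2l pq0) hl -(ler_pM2l pq0).
Qed.

(** Every nonempty set of at most [K] points is the range of a [K]-tuple. *)
Lemma card_small_sets (T : finType) K :
  (#|[set I : {set T} | (0 < #|I| <= K)%N]%SET| <= #|T| ^ K)%N.
Proof.
case: K => [|K].
  rewrite (_ : [set _ | _]%SET = finset.set0) ?cards0//.
  by apply/setP => I; rewrite !inE; case: #|I|.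
rewrite -[X in (#|T| ^ X)%N]card_ord -card_ffun.
pose g (f : {ffun 'I_K.+1 -> T}) : {set T} := [set f k | k in 'I_K.+1]%SET.
apply: leq_trans (leq_imset_card g _).
apply: subset_leq_card; apply/fintype.subsetP => I; rewrite inE => /andP[I0 cI].
have [x0 x0I] : exists x0, x0 \in I by apply/card_gt0P.
apply/imsetP; exists [ffun k : 'I_K.+1 => nth x0 (enum I) k] => //.
apply/setP => x; apply/idP/imsetP => [xI|[k _ ->]].
  have xk : (index x (enum I) < K.+1)%N.
    by apply: leq_trans cI; rewrite cardE index_mem mem_enum.
  by exists (Ordinal xk) => //; rewrite ffunE/= nth_index// mem_enum.
rewrite ffunE; have [kI|kI] := ltnP k (size (enum I)).
  by rewrite -mem_enum mem_nth.
by rewrite nth_default.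
Qed.

(** * Gaussian integrals *)

Local Open Scope classical_set_scope.

Section density.
Local Open Scope ereal_scope.
Context d (T : measurableType d) (R : realType).
Variables (mu nu : {measure set T -> \bar R}) (h : T -> R).
Hypothesis mh : measurable_fun setT h.
Hypothesis h0 : forall x, (0 <= h x)%R.
Hypothesis nuE : forall A, measurable A -> nu A = \int[mu]_(x in A) (h x)%:E.
Import HBNNSimple.

Let integral_density_nnsfun (f : {nnsfun T >-> R}) :
  \int[nu]_x (f x)%:E = \int[mu]_x ((f x)%:E * (h x)%:E).
Proof.
under [LHS]eq_integral do rewrite fimfunE -fsumEFin//.
rewrite [LHS]ge0_integral_fsum//; last 2 first.
  - by move=> r; exact/measurable_EFinP/measurableT_comp.
  - by move=> n x _; rewrite EFinM nnfun_muleindic_ge0.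
under [RHS]eq_integral.
  move=> x xD; rewrite fimfunE -fsumEFin// ge0_mule_fsuml; last first.
    by move=> r; rewrite EFinM nnfun_muleindic_ge0.
  over.
rewrite [RHS]ge0_integral_fsum//; last 2 first.
  - move=> r; apply: emeasurable_funM; last exact/measurable_EFinP.
    exact/measurable_EFinP/measurableT_comp.
  - move=> n x _; apply: mule_ge0; last by rewrite lee_fin.
    by rewrite EFinM nnfun_muleindic_ge0.
apply: eq_fsbigr => r _.
have mfr : measurable (f @^-1` [set r]) by exact: measurable_sfunP.
under [RHS]eq_integral do rewrite EFinM -muleA.
have [r0|r0] := leP 0%R r; last first.
  have fr0 : f @^-1` [set r] = set0.
    apply/seteqP; split => // x /= fx.
    have : (0 <= f x)%R by exact: fun_ge0.
    by rewrite fx leNgt r0.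
  rewrite fr0; under eq_integral do rewrite indic0 mulr0.
  rewrite integral0; under eq_integral do rewrite indic0 mul0e mule0.
  by rewrite integral0.
under eq_integral do rewrite EFinM.
rewrite !ge0_integralZl//; last 3 first.
  - by apply: emeasurable_funM; exact/measurable_EFinP.
  - by move=> x _; rewrite -EFinM lee_fin mulr_ge0.
  - exact/measurable_EFinP.
congr (_ * _); rewrite integral_indic// setIT nuE//.
rewrite integral_mkcond; apply: eq_integral => x _.
rewrite patchE indicE; case: ifPn => _; by rewrite ?mul1e ?mul0e.
Qed.

(** Both sides agree on simple functions and pass to monotone limits. *)
Lemma ge0_integral_density (f : T -> \bar R) :
  measurable_fun setT f -> (forall x, 0 <= f x) ->
  \int[nu]_x f x = \int[mu]_x (f x * (h x)%:E).
Proof.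
move=> mf f0; pose f_ := nnsfun_approx measurableT mf.
transitivity (limn (fun n => \int[nu]_x (f_ n x)%:E)).
  rewrite -monotone_convergence//=.
  - apply: eq_integral => x _; apply/esym/cvg_lim => //=.
    exact: cvg_nnsfun_approx.
  - by move=> n; exact/measurable_EFinP/measurable_funTS.
  - by move=> n x _; rewrite lee_fin.
  - by move=> x _ m n mn; rewrite lee_fin; exact/lefP/nd_nnsfun_approx.
under eq_fun do rewrite integral_density_nnsfun.
rewrite -monotone_convergence//=.
- apply: eq_integral => x _; apply/cvg_lim => //=.
  apply: cvgeZr => //; exact: cvg_nnsfun_approx.
- move=> n; apply: emeasurable_funM; exact/measurable_EFinP.
- by move=> n x _; rewrite -EFinM lee_fin mulr_ge0.
- move=> x _ m n mn; rewrite -!EFinM lee_fin ler_wpM2r//.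
  exact/lefP/nd_nnsfun_approx.
Qed.
End density.

Lemma complete_square (R : realFieldType) (sg s a b x v : R) : sg != 0 -> v != 0 ->
  v = 1 - 2 * s * sg ^+ 2 * b ^+ 2 ->
  s * (a + b * x) ^+ 2 - x ^+ 2 / (2 * sg ^+ 2) =
  s / v * a ^+ 2 - (x - 2 * s * a * b * sg ^+ 2 / v) ^+ 2 / (2 * (sg ^+ 2 / v)).
Proof.
move=> sg0 v0 vE.
have vb : 2 * s * sg ^+ 2 * b ^+ 2 = 1 - v by rewrite vE; ring.
apply/(mulIf sg0)/(mulIf sg0)/(mulIf v0).
(* The coefficient of [b ^+ 2] is isolated on each side and eliminated by [vb]. *)
transitivity ((2 * s * sg ^+ 2 * b ^+ 2) * v * x ^+ 2 / 2 +
    s * v * sg ^+ 2 * a ^+ 2 + 2 * s * a * b * sg ^+ 2 * v * x -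
    v * x ^+ 2 / 2).
  by field.
rewrite vb.
transitivity (s * sg ^+ 2 * a ^+ 2 - v ^+ 2 * x ^+ 2 / 2 +
    2 * s * a * b * sg ^+ 2 * v * x -
    (2 * s * sg ^+ 2 * b ^+ 2) * s * a ^+ 2 * sg ^+ 2).
  by rewrite vb; field.
by field; rewrite ?v0 ?sg0.
Qed.

(** By [complete_square] the integrand times the normal density is a multiple of
    the density of the normal law of mean [m'] and standard deviation [sg']. *)
Lemma integral_normal_prob_expR_sqr (R : realType) (sg s a b : R) :
  0 < sg -> 2 * s * sg ^+ 2 * b ^+ 2 < 1 ->
  (\int[normal_prob 0 sg]_x (expR (s * (a + b * x) ^+ 2))%:E =
   (Num.sqrt (1 - 2 * s * sg ^+ 2 * b ^+ 2))^-1%:E *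
    (expR (s / (1 - 2 * s * sg ^+ 2 * b ^+ 2) * a ^+ 2))%:E)%E.
Proof.
move=> sg0 sb1; set v := 1 - _.
have v0 : 0 < v by rewrite subr_gt0.
pose sg' := sg / Num.sqrt v; pose m' := 2 * s * a * b * sg ^+ 2 / v.
have sv0 : 0 < Num.sqrt v by rewrite sqrtr_gt0.
have sg'0 : 0 < sg' by rewrite divr_gt0.
have svE : Num.sqrt v ^+ 2 = v by rewrite sqr_sqrtr// ltW.
have mexp : measurable_fun setT (fun x : R => expR (s * (a + b * x) ^+ 2)).
  apply: measurableT_comp => //; apply: measurable_funM => //.
  by apply: measurable_funX; apply: measurable_funD => //; exact: measurable_funM.
have mf : measurable_fun setT (fun x : R => (expR (s * (a + b * x) ^+ 2))%:E).
  exact/measurable_EFinP.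
rewrite (@ge0_integral_density _ _ _ lebesgue_measure (normal_prob 0 sg) _
  (measurable_normal_pdf 0 sg)
  (normal_pdf_ge0 0 sg) (fun _ _ => erefl) _ mf); last first.
  by move=> x; rewrite lee_fin expR_ge0.
set c := ((Num.sqrt v)^-1 * expR (s / v * a ^+ 2)).
transitivity (\int[lebesgue_measure]_x (c%:E * (normal_pdf m' sg' x)%:E))%E.
  apply: eq_integral => x _; rewrite -!EFinM; congr (_%:E).
  rewrite !normal_pdfE ?gt_eqF// /normal_peak /normal_fun /c.
  rewrite /sg' expr_div_n svE.
  have -> : Num.sqrt (sg ^+ 2 / v * pi *+ 2) = Num.sqrt (sg ^+ 2 * pi *+ 2) / Num.sqrt v.
    rewrite -sqrtrV ?(ltW v0)// -sqrtrM; last first.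
      by rewrite mulrn_wge0// mulr_ge0 ?pi_ge0// sqr_ge0.
    by rewrite mulrnAl [in LHS]mulrAC.
  set q := Num.sqrt (sg ^+ 2 * pi *+ 2).
  have q0 : 0 < q.
    by rewrite sqrtr_gt0 mulrn_wgt0// mulr_gt0 ?pi_gt0// exprn_gt0.
  have -> : - (x - 0) ^+ 2 / (sg ^+ 2 *+ 2) = - (x ^+ 2 / (2 * sg ^+ 2)).
    by rewrite subr0 mulNr mulr_natl.
  have -> : - (x - m') ^+ 2 / (sg ^+ 2 / v *+ 2) =
            - ((x - m') ^+ 2 / (2 * (sg ^+ 2 / v))).
    by rewrite mulNr mulr_natl.
  rewrite mulrCA -expRD (@complete_square _ sg s a b x v) ?gt_eqF//.
  rewrite invf_div expRD [RHS]mulrACA.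
  by congr (_ * _); rewrite mulrA mulVf ?mul1r// gt_eqF.
rewrite ge0_integralZl//.
- by rewrite integral_normal_pdf mule1 EFinM.
- apply/measurable_EFinP; exact: measurable_normal_pdf.
- by move=> x _; rewrite lee_fin normal_pdf_ge0.
- by rewrite lee_fin /c mulr_ge0 ?invr_ge0 ?sqrtr_ge0 ?expR_ge0.
Qed.

(** * Independence *)

Section freezing.
Local Open Scope ereal_scope.
Context d d1 d2 (T : measurableType d) (T1 : measurableType d1)
  (T2 : measurableType d2) (R : realType) (P : probability T R).
Variables (Y : {mfun T >-> T1}) (Z : {mfun T >-> T2}).
Hypothesis indepYZ : forall A B, measurable A -> measurable B ->
  P (Y @^-1` A `&` Z @^-1` B) = P (Y @^-1` A) * P (Z @^-1` B).

Let YZ : T -> T1 * T2 := fun w => (Y w, Z w).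
Let mYZ : measurable_fun setT YZ.
Proof. exact: measurable_fun_pair. Qed.
HB.instance Definition _ := isMeasurableFun.Build _ _ _ _ YZ mYZ.

(** The joint law of [Y] and [Z] is the product of their laws, since the two agree
    on rectangles; Tonelli's theorem then allows integrating over [Z] first. *)
Lemma ge0_integral_indep (f : T1 * T2 -> \bar R) :
  measurable_fun setT f -> (forall x, 0 <= f x) ->
  \int[P]_w f (Y w, Z w) = \int[P]_w \int[distribution P Z]_z f (Y w, z).
Proof.
move=> mf f0.
transitivity (\int[distribution P YZ]_x f x).
  by rewrite ge0_integral_distribution.
transitivity (\int[distribution P Y \x distribution P Z]_x f x).
  apply: eq_measure_integral => A mA _.
  by apply/esym; apply: product_measure_unique => //= B C mB mC; exact: indepYZ.
rewrite fubini_tonelli1// ge0_integral_distribution//.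
- exact: measurable_fun_fubini_tonelli_F.
- by move=> y; exact: integral_ge0.
Qed.

End freezing.

Section peel.
Local Open Scope ereal_scope.
Context d (T : measurableType d) (R : realType) (P : probability T R).
Variables (I : finType) (X : I -> {RV P >-> R}).
Hypothesis indepX : mutually_independent X.

(** A pi-system generating the sigma-algebra of the variables indexed by [J].
    This sigma-algebra is placed on the sample space itself, so that the identity
    map plays the role of the vector of these variables. *)
Definition cylinders (J : {set I}) : set (set T) :=
  [set E | exists2 A : I -> set R, (forall i, measurable (A i)) &
    E = [set w | forall i, i \in J -> A i (X i w)]].

Lemma cylinders_measurable J : cylinders J `<=` measurable.
Proof.
move=> _ [A mA ->].
rewrite (_ : [set _ | _] = \bigcap_(i in [set` J]) (X i @^-1` A i))//.
apply: fin_bigcap_measurable => // i _; rewrite -[X in measurable X]setTI.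
exact: measurable_funP.
Qed.

Lemma cylinders_setI J : setI_closed (cylinders J).
Proof.
move=> _ _ [A mA ->] [B mB ->]; exists (fun i => A i `&` B i).
  by move=> i; exact: measurableI.
apply/seteqP; split => [w [wA wB] i iJ|w wAB]; first by split; auto.
by split => i iJ; have [] := wAB i iJ.
Qed.

(** For fixed [B] both sides are finite measures in [E]; mutual independence makes
    them agree on the pi-system, hence on the sigma-algebra it generates. *)
Lemma indep_cylinders (J : {set I}) (k : I) : k \notin J -> forall E B,
  <<s cylinders J >> E -> measurable B ->
  P (E `&` X k @^-1` B) = P E * P (X k @^-1` B).
Proof.
move=> kJ E B sE mB.
have mXB : measurable (X k @^-1` B).
  by rewrite -[X in measurable X]setTI; exact: measurable_funP.
have [c c0 cE] : exists2 c : {nonneg R}, True & P (X k @^-1` B) = (c%:num)%:E.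
  have h := fin_num_measure P _ mXB.
  have h0 : (0 <= fine (P (X k @^-1` B)))%R by rewrite fine_ge0.
  by exists (NngNum h0) => //=; rewrite fineK.
have -> : P (E `&` X k @^-1` B) = mrestr P mXB E by [].
rewrite cE muleC; have -> : c%:num%:E * P E = mscale c P E by [].
apply: (@g_sigma_algebra_measure_unique _ _ _ (cylinders J) _ (fun=> setT) _ _
  (mrestr P mXB) (mscale c P)) => //.
- exact: cylinders_measurable.
- move=> _; exists (fun=> setT) => //.
  by apply/seteqP; split.
- by rewrite bigcup_const.
- exact: cylinders_setI.
- move=> _ [A mA ->].
  pose A' i := if i == k then B else A i.
  have mA' i : measurable (A' i) by rewrite /A'; case: ifP.
  transitivity (P [set w | forall i, i \in k |: J -> A' i (X i w)]).
    congr (P _); apply/seteqP; split => [w [/= wA wB] i|w /= wA'].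
      rewrite !inE /A'; case: eqP => [->//|_ /=]; exact: wA.
    split.
      move=> i iJ; have := wA' i; rewrite !inE iJ orbT /A' ifN; first exact.
      by apply: contraNneq kJ => <-.
    by have := wA' k; rewrite !inE /A' eqxx; exact.
  rewrite -[RHS]/(c%:num%:E * P _) -cE !indepX// big_setU1//= /A' eqxx; congr (_ * _).
  apply: eq_bigr => i iJ; rewrite ifN//.
  by apply: contraNneq kJ => <-.
- move=> n; apply: le_lt_trans (ltry 1).
  by apply: probability_le1; exact: measurableI.
Qed.

(** The integrand is a joint function of [X k] and of the variables indexed by
    [J]; a quadratic form in the entries of a row couples the two. *)
Lemma ge0_integral_peel (J : {set I}) (k : I)
    (f : g_sigma_algebraType (cylinders J) * R -> \bar R) : k \notin J ->
  measurable_fun setT f -> (forall x, 0 <= f x) ->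
  \int[P]_w f (w, X k w) = \int[P]_w \int[distribution P (X k)]_x f (w, x).
Proof.
move=> kJ mf f0.
pose Y : T -> g_sigma_algebraType (cylinders J) := id.
have mY : measurable_fun setT Y.
  move=> _ A mA; rewrite setTI; move: A mA.
  apply: smallest_sub; first exact: sigma_algebra_measurable.
  exact: cylinders_measurable.
pose Ymix := isMeasurableFun.Build _ _ _ _ Y mY.
pose Ym : {mfun T >-> g_sigma_algebraType (cylinders J)} := HB.pack Y Ymix.
apply: (@ge0_integral_indep _ _ _ _ _ _ _ P Ym (X k)) => // A B mA mB.
exact: (indep_cylinders kJ).
Qed.

Lemma measurable_cylinders (J : {set I}) i : i \in J ->
  measurable_fun setT (X i : g_sigma_algebraType (cylinders J) -> R).
Proof.
move=> iJ _ A mA; rewrite setTI; apply: sub_sigma_algebra.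
exists (fun j => if j == i then A else setT).
  by move=> j; case: ifP.
apply/seteqP; split => [w /= Aw j jJ|w /= /(_ i iJ)]; last by rewrite eqxx.
by case: eqP => // ->.
Qed.

End peel.

(** * Gaussian quadratic forms *)

Lemma measurable_sum_cond d (T : measurableType d) (R : realType) (J : finType)
    (p : pred J) (h : J -> T -> R) :
  (forall i, p i -> measurable_fun setT (h i)) ->
  measurable_fun setT (fun x => \sum_(i | p i) h i x).
Proof.
move=> mh; pose g i x := if p i then h i x else 0.
rewrite (_ : (fun x => _) = fun x => \sum_i g i x); last first.
  by apply/funext => x; rewrite big_mkcond.
apply: (@measurable_sum _ _ _ setT _ _ g) => i; rewrite /g.
by case: (boolP (p i)) => [/mh//|_]; exact: measurable_cst.
Qed.

(** The law of [Y] and the normal law are measures on two measurable types that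
    have the same carrier and the same measurable sets, but not the same display;
    [Y] is therefore also viewed as a map into the second type. *)
Lemma ge0_integral_gaussian d (T : measurableType d) (R : realType)
    (P : probability T R) (Y : {RV P >-> R}) (sg : R) (g : R -> \bar R) :
  (forall A, measurable A -> distribution P Y A = normal_prob 0 sg A) ->
  measurable_fun setT g -> (forall x, 0 <= g x)%E ->
  (\int[distribution P Y]_x g x = \int[normal_prob 0 sg]_x g x)%E.
Proof.
move=> gaussY mg g0; rewrite ge0_integral_distribution//.
pose W : T -> measurableTypeR R := Y.
have mW : measurable_fun setT W by move=> _ A mA; exact: (measurable_funPT Y).
pose Wm : {mfun T >-> measurableTypeR R} := HB.pack W (isMeasurableFun.Build _ _ _ _ W mW).
transitivity (\int[distribution P Wm]_x g x)%E.
  by rewrite ge0_integral_distribution.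
apply: eq_measure_integral => A mA _; exact: gaussY.
Qed.

Section quadratic_mgf.
Context d (T : measurableType d) (R : realType) (P : probability T R).
Variables (I Q : finType) (rho : I -> Q) (c : I -> R) (X : I -> {RV P >-> R}).
Variable sg : R.
Implicit Types (S : {set I}) (k : I) (q : Q).
Hypothesis sg0 : 0 < sg.
Hypothesis indepX : mutually_independent X.
Hypothesis gaussX : forall i A, measurable A ->
  distribution P (X i) A = normal_prob 0 sg A.

(** The indices are distributed among the elements of [Q] by [rho], as the entries
    of a matrix among its rows, and each element of [Q] carries one linear form. *)
Definition fiber_sum (S : {set I}) (q : Q) (w : T) : R :=
  \sum_(i in S | rho i == q) c i * X i w.

Definition fiber_var (S : {set I}) (q : Q) : R :=
  sg ^+ 2 * \sum_(i in S | rho i == q) c i ^+ 2.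

Lemma fiber_var_ge0 S q : 0 <= fiber_var S q.
Proof. by rewrite mulr_ge0 ?sqr_ge0// sumr_ge0// => i _; exact: sqr_ge0. Qed.

Lemma fiber_sumU1 S k q w : k \notin S -> fiber_sum (k |: S) q w =
  (if rho k == q then c k * X k w else 0) + fiber_sum S q w.
Proof. by move=> kS; rewrite /fiber_sum big_mkcondr big_setU1//= -big_mkcondr. Qed.

Lemma fiber_varU1 S k q : k \notin S -> fiber_var (k |: S) q =
  (if rho k == q then sg ^+ 2 * c k ^+ 2 else 0) + fiber_var S q.
Proof.
move=> kS; rewrite /fiber_var [X in _ * X = _]big_mkcondr big_setU1//= -big_mkcondr.
by rewrite mulrDr; case: eqP; rewrite ?mulr0.
Qed.

Lemma measurable_fiber_sum S q :
  measurable_fun setT (fiber_sum S q : g_sigma_algebraType (cylinders X S) -> R).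
Proof.
apply: (measurable_sum_cond (p := fun i => (i \in S) && (rho i == q))
  (h := fun i (w : g_sigma_algebraType (cylinders X S)) => c i * X i w)).
move=> i /andP[iS _].
by apply: measurable_funM; [exact: measurable_cst|exact: measurable_cylinders].
Qed.

Lemma measurable_fiber_sumT S q : measurable_fun setT (fiber_sum S q).
Proof.
apply: (measurable_sum_cond (p := fun i => (i \in S) && (rho i == q))
  (h := fun i w => c i * X i w)) => i _.
by apply: measurable_funM.
Qed.

(** The variables are integrated out one at a time.  Removing [k] from [S] produces
    the factor D^(-1/2) and replaces the coefficient [s] of the form containing
    [k] by s / D, where D = 1 - 2 s sg^2 (c k)^2.  If V and V' are the variances of
    that form before and after, D (1 - 2 (s / D) V') = 1 - 2 s V, so the factors
    telescope.  The coefficients may be negative, which is the case of the lower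
    tail. *)
Lemma quadratic_mgf (S : {set I}) (s : Q -> R) :
  (forall q, 2 * s q * fiber_var S q < 1) ->
  (\int[P]_w (expR (\sum_q s q * fiber_sum S q w ^+ 2))%:E =
   (\prod_q (Num.sqrt (1 - 2 * s q * fiber_var S q))^-1)%:E)%E.
Proof.
have [n] := ubnP #|S|; elim: n => // n IHn in S s *.
have [->|[k kS]] := set_0Vmem S.
  move=> _ _.
  have f0 q w : fiber_sum finset.set0 q w = 0.
    by apply: big_pred0 => i; rewrite inE.
  have v0 q : fiber_var finset.set0 q = 0.
    by rewrite /fiber_var big_pred0 ?mulr0// => i; rewrite inE.
  under eq_integral => w _.
    rewrite big1 ?expR0; last by move=> q _; rewrite f0 expr0n mulr0.
    over.
  rewrite integral_cst//= probability_setT mule1 big1// => q _.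
  by rewrite v0 mulr0 subr0 sqrtr1 invr1.
rewrite -(finset.setD1K kS) cardsU1 !inE eqxx/= add1n ltnS.
set S' := S :\ k => ltSn hs.
have kS' : k \notin S' by rewrite !inE eqxx.
pose q0 := rho k; pose D := 1 - 2 * s q0 * sg ^+ 2 * c k ^+ 2.
have varq0 : fiber_var (k |: S') q0 = sg ^+ 2 * c k ^+ 2 + fiber_var S' q0.
  by rewrite fiber_varU1// eqxx.
have ck0 : 0 <= sg ^+ 2 * c k ^+ 2 by rewrite mulr_ge0 ?sqr_ge0.
(* Either the coefficient is nonpositive, or the variance of the whole form
   bounds the contribution of [k]. *)
have D1 : 2 * s q0 * sg ^+ 2 * c k ^+ 2 < 1.
  have := hs q0; rewrite varq0 -mulrA; have := fiber_var_ge0 S' q0.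
  by have [s0|s0] := leP 0 (s q0); nra.
have D0 : 0 < D by rewrite subr_gt0.
pose s' q := if q == q0 then s q0 / D else s q.
pose rest w := \sum_(q | q != q0) s q * fiber_sum S' q w ^+ 2.
pose f (z : g_sigma_algebraType (cylinders X S') * R) : \bar R :=
  (expR (rest z.1 + s q0 * (fiber_sum S' q0 z.1 + c k * z.2) ^+ 2))%:E.
have hs' q : 2 * s' q * fiber_var S' q < 1.
  rewrite /s'; have [->|qq0] := eqVneq q q0.
    rewrite (_ : 2 * _ * _ = 2 * s q0 * fiber_var S' q0 / D); last by ring.
    rewrite ltr_pdivrMr// mul1r.
    by have := hs q0; rewrite varq0 /D; nra.
  by have := hs q; rewrite fiber_varU1// ifN ?add0r// eq_sym.
have mrest : measurable_fun setT (rest : g_sigma_algebraType (cylinders X S') -> R).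
  apply: (measurable_sum_cond (h := fun q (w : g_sigma_algebraType (cylinders X S'))
    => s q * fiber_sum S' q w ^+ 2)) => q _.
  by apply: measurable_funM => //; apply: measurable_funX; exact: measurable_fiber_sum.
pose fs : g_sigma_algebraType (cylinders X S') -> R := fiber_sum S' q0.
have mfs : measurable_fun setT fs by exact: measurable_fiber_sum.
transitivity (\int[P]_w f (w, X k w))%E.
  apply: eq_integral => w _; congr (expR _)%:E.
  rewrite (bigD1 q0)//= addrC; congr (_ + _).
    apply: eq_bigr => q qq0; rewrite fiber_sumU1// ifN ?add0r//.
    by rewrite eq_sym.
  by rewrite fiber_sumU1// eqxx addrC.
rewrite (ge0_integral_peel indepX kS'); last 2 first.
- apply/measurable_EFinP; apply: measurableT_comp => //; apply: measurable_funD.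
    exact: (measurableT_comp mrest measurable_fst).
  apply: measurable_funM => //; apply: measurable_funX; apply: measurable_funD.
    exact: (measurableT_comp mfs measurable_fst).
  exact: measurable_funM.
- by move=> z; rewrite /f lee_fin expR_ge0.
transitivity (\int[P]_w ((Num.sqrt D)^-1%:E *
    (expR (\sum_q s' q * fiber_sum S' q w ^+ 2))%:E))%E.
  apply: eq_integral => w _.
  have mquad : measurable_fun setT (fun x : R =>
      (expR (s q0 * (fiber_sum S' q0 w + c k * x) ^+ 2))%:E).
    apply/measurable_EFinP; apply: measurableT_comp => //.
    apply: measurable_funM => //; apply: measurable_funX.
    by apply: measurable_funD => //; exact: measurable_funM.
  rewrite /f/=; under eq_integral do rewrite expRD EFinM.
  rewrite ge0_integralZl//.
  rewrite (ge0_integral_gaussian (gaussX k) mquad); last first.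
    by move=> x; rewrite lee_fin expR_ge0.
  rewrite integral_normal_prob_expR_sqr// muleCA; congr (_ * _)%E.
  have -> : \sum_q s' q * fiber_sum S' q w ^+ 2 =
      rest w + s q0 / D * fiber_sum S' q0 w ^+ 2.
    rewrite (bigD1 q0)//= {1}/s' eqxx addrC; congr (_ + _).
    by apply: eq_bigr => q qq0; rewrite /s' (negbTE qq0).
  by rewrite expRD EFinM.
rewrite ge0_integralZl//.
- rewrite (IHn _ _ ltSn hs') -EFinM; congr _%:E.
  rewrite (bigD1 q0)//= [in RHS](bigD1 q0)//= mulrA; congr (_ * _).
    rewrite -invfM -sqrtrM ?(ltW D0)//; congr (Num.sqrt _)^-1.
    rewrite varq0 /s' eqxx mulrBr mulr1.
    rewrite (_ : D * (2 * _ * _) = 2 * s q0 * fiber_var S' q0); last first.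
      by field; rewrite gt_eqF.
    by rewrite /D; ring.
  apply: eq_bigr => q qq0; rewrite /s' (negbTE qq0) fiber_varU1// ifN ?add0r//.
  by rewrite eq_sym.
- apply/measurable_EFinP; apply: measurableT_comp => //.
  apply: (measurable_sum_cond (h := fun q w => s' q * fiber_sum S' q w ^+ 2)) => q _.
  by apply: measurable_funM => //; apply: measurable_funX; exact: measurable_fiber_sumT.
Qed.

End quadratic_mgf.

(** * Concentration of the energy *)

(** In the variable u = 1 + x, the derivative of the difference of the two sides
    is (u - 1)^3 / u, which has the sign of u - 1; the difference is thus minimal
    at u = 1, where it vanishes.  Negative values of [x] are included because
    they describe the lower tail. *)
Lemma ln_cubic_ub (R : realType) (x : R) : -1 < x ->
  ln (1 + x) <= x - x ^+ 2 / 2 + x ^+ 3 / 3.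
Proof.
move=> x1.
pose g : R -> R := (cst (1/3) * id ^+ 3 - cst (3/2) * id ^+ 2 + cst 3 * id - @ln R).
pose g' (u : R) := (u - 1) ^+ 3 / u.
have dg (u : R) : 0 < u -> is_derive u 1 g (g' u).
  move=> u0; have dln := is_derive1_ln u0.
  apply: is_derive_eq; rewrite /g' /GRing.scale/= !fctE/=.
  by field; rewrite gt_eqF.
have gE (u : R) : g u = 1/3 * u ^+ 3 - 3/2 * u ^+ 2 + 3 * u - ln u.
  by rewrite /g !fctE.
have cg (a b : R) : 0 < a -> {within `[a, b], continuous g}.
  move=> a0; apply: derivable_within_continuous => u; rewrite in_itv/= => /andP[au _].
  by case: (dg u (lt_le_trans a0 au)).
suff : g 1 <= g (1 + x) by rewrite !gE ln1; nra.
have [x0|x0] := leP 0 x.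
  have [|||c] := @MVT_segment R g g' 1 (1 + x).
  - by rewrite lerDl.
  - by move=> u; rewrite in_itv/= => /andP[u1 _]; apply: dg; lra.
  - by exact: cg.
  rewrite in_itv/= => /andP[c1 _] eg; rewrite -subr_ge0 eg mulr_ge0//; last lra.
  by rewrite divr_ge0 ?exprn_ge0 ?subr_ge0//; lra.
have [|||c] := @MVT_segment R g g' (1 + x) 1.
- by rewrite gerDl ltW.
- by move=> u; rewrite in_itv/= => /andP[u1 _]; apply: dg; lra.
- by apply: cg; lra.
rewrite in_itv/= => /andP[xc c1] eg; rewrite -subr_le0 eg /g'.
have -> : (c - 1) ^+ 3 / c * (1 - (1 + x)) = - ((1 - c) ^+ 3 / c * - x) by ring.
rewrite oppr_le0 mulr_ge0//; last lra.
by rewrite divr_ge0 ?exprn_ge0 ?subr_ge0//; lra.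
Qed.

(** A bound for the probability that a chi-square variable with [m] degrees of
    freedom, divided by [m], deviates from 1 by more than [e], when 0 < e < 1. *)
Definition chi2_tail (R : realType) (m : nat) (e : R) : R :=
  2 * expR (- (m%:R / 2 * (e ^+ 2 / 2 - e ^+ 3 / 3))).

Section energy.
Context d (T : measurableType d) (R : realType) (P : probability T R).
Variables (m n : nat) (X : 'I_m * 'I_n -> {RV P >-> R}).
Hypothesis m0 : (0 < m)%N.
Hypothesis indepX : mutually_independent X.
Hypothesis gaussX : forall ij, gaussian_rv (X ij) 0 (1 / m%:R).

Definition energy (b : 'I_n -> R) (w : T) : R :=
  \sum_r (\sum_j b j * X (r, j) w) ^+ 2.

Lemma measurable_energy b : measurable_fun setT (energy b).
Proof.
apply: measurable_sum => r; apply: measurable_funX.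
by apply: measurable_sum => j; exact: measurable_funM.
Qed.

Lemma measurable_energy_dev b (a c : R) :
  measurable [set w | a < `|energy b w - c|].
Proof.
rewrite (_ : [set _ | _] = ~` (setT `&` [set w | `|energy b w - c| <= a])).
  apply: measurableC; apply: measurable_fun_le => //.
  apply: measurableT_comp => //.
  by apply: measurable_funB => //; exact: measurable_energy.
by rewrite setTI; apply/seteqP; split => w /=; rewrite ltNge; move/negP.
Qed.

(** The parameter is scaled so that [t] is the argument of the moment generating
    function of a chi-square variable, up to the usual factor 2: the answer is the
    power - m / 2 of 1 - t. *)
Lemma energy_mgf (b : 'I_n -> R) (t : R) :
  let B := \sum_j b j ^+ 2 in 0 < B -> t < 1 ->
  (\int[P]_w (expR (t * m%:R / (2 * B) * energy b w))%:E =
   ((Num.sqrt (1 - t))^-1 ^+ m)%:E)%E.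
Proof.
move=> B B0 t1.
have sg0 : 0 < Num.sqrt (1 / m%:R) :> R by rewrite sqrtr_gt0 divr_gt0 ?ltr0n.
pose c (ij : 'I_m * 'I_n) := b ij.2.
have rowE (V : nmodType) (F : 'I_m * 'I_n -> V) (r : 'I_m) :
    \sum_(ij in [set: 'I_m * 'I_n]%SET | ij.1 == r) F ij = \sum_j F (r, j).
  rewrite (reindex_onto (fun j => (r, j)) snd)/=; last first.
    by move=> [i j]/= /andP[_ /eqP->].
  by apply: eq_bigl => j; rewrite inE !eqxx.
have varE r : fiber_var fst c (Num.sqrt (1 / m%:R)) [set: 'I_m * 'I_n]%SET r = B / m%:R.
  by rewrite /fiber_var rowE sqr_sqrtr ?divr_ge0// mul1r mulrC.
have m0' : m%:R != 0 :> R by rewrite pnatr_eq0 -lt0n.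
have sE : 2 * (t * m%:R / (2 * B)) * (B / m%:R) = t.
  by field; rewrite m0' gt_eqF.
have := @quadratic_mgf _ T R P _ _ fst c X _ sg0 indepX
  (fun ij => gaussX ij) [set: 'I_m * 'I_n]%SET (fun=> t * m%:R / (2 * B)).
move=> /(_ _) H; rewrite [RHS](_ : _ =
  (\prod_(r < m) (Num.sqrt (1 - 2 * (t * m%:R / (2 * B)) *
    fiber_var fst c (Num.sqrt (1 / m%:R)) [set: 'I_m * 'I_n]%SET r))^-1)%:E).
  rewrite -H; last by move=> r; rewrite varE sE.
  apply: eq_integral => w _; congr (expR _)%:E.
  by rewrite /energy mulr_sumr; apply: eq_bigr => r _; rewrite /fiber_sum rowE.
congr _%:E; under eq_bigr do rewrite varE sE.
by rewrite prodr_const card_ord.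
Qed.

(** Chernoff's bound with the optimal parameter t = x / (1 + x).  The factor [x] in
    the event makes it the upper tail for positive [x] and the lower tail for
    negative [x]. *)
Lemma energy_tail (b : 'I_n -> R) (x : R) :
  let B := \sum_j b j ^+ 2 in 0 < B -> -1 < x ->
  (P [set w | 0 <= x * (energy b w - (1 + x) * B)]%R <=
   (expR (m%:R / 2 * (ln (1 + x) - x)))%:E)%E.
Proof.
move=> B B0 x1; have x10 : 0 < 1 + x by lra.
pose t := x / (1 + x).
have tE : 1 - t = (1 + x)^-1 by rewrite /t; field; rewrite gt_eqF.
have t1 : t < 1 by rewrite -subr_gt0 tE invr_gt0.
pose lam := t * m%:R / (2 * B).
have mE := measurable_energy b.
set E := [set w | _].
have mEv : measurable E.
  rewrite /E -[X in measurable X]setTI.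
  apply: measurable_fun_le => //; apply: measurable_funM => //.
  exact: measurable_funB.
have me : measurable_fun setT (fun w => (expR (lam * energy b w))%:E).
  apply/measurable_EFinP; apply: measurableT_comp => //.
  exact: measurable_funM.
rewrite -(setIT E) -integral_indic//.
apply: (@le_trans _ _ (\int[P]_w ((expR (- (lam * ((1 + x) * B))))%:E *
    (expR (lam * energy b w))%:E))%E).
  apply: ge0_le_integral => //.
  - exact/measurable_EFinP.
  - exact: measurable_funeM.
  - move=> w _; rewrite -EFinM -expRD lee_fin indicE.
    case: (boolP (w \in E)) => [|_]; last exact: expR_ge0.
    rewrite inE /E/= => wE; rewrite -[leLHS]expR0 ler_expR.
    have -> : - (lam * ((1 + x) * B)) + lam * energy b w =
        (m%:R / (2 * B * (1 + x))) * (x * (energy b w - (1 + x) * B)).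
      by rewrite /lam /t; field; rewrite !gt_eqF.
    by rewrite mulr_ge0// divr_ge0// ?mulr_ge0// ltW.
rewrite ge0_integralZl//.
rewrite energy_mgf// -EFinM lee_fin tE sqrtrV ?(ltW x10)// invrK.
have -> : Num.sqrt (1 + x) = expR (ln (1 + x) / 2).
  have e2 : 1 + x = expR (ln (1 + x) / 2) ^+ 2.
    by rewrite -expRM_natl mulrC divfK// lnK// posrE.
  by rewrite [in LHS]e2 sqrtr_sqr ger0_norm ?expR_ge0.
rewrite -expRM_natl -expRD ler_expR /lam /t.
rewrite le_eqVlt; apply/orP; left; apply/eqP.
by field; rewrite !gt_eqF.
Qed.

Lemma energy_concentration (b : 'I_n -> R) (e : R) :
  let B := \sum_j b j ^+ 2 in 0 < B -> 0 < e -> e < 1 ->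
  (P [set w | e * B < `|energy b w - B|]%R <=
   (chi2_tail m e)%:E)%E.
Proof.
move=> B B0 e0 e1; rewrite /chi2_tail.
have mE := measurable_energy b.
have mEv (x : R) : measurable [set w | 0 <= x * (energy b w - (1 + x) * B)].
  rewrite -[X in measurable X]setTI.
  apply: measurable_fun_le => //; apply: measurable_funM => //.
  exact: measurable_funB.
pose E x := [set w | 0 <= x * (energy b w - (1 + x) * B)].
apply: (@le_trans _ _ (P (E e `|` E (- e)))).
  apply: le_measure; rewrite ?inE.
  - exact: measurable_energy_dev.
  - by apply: measurableU; exact: mEv.
  - move=> w /=; rewrite ltr_normr /E/= => /orP[h|h]; [left|right].
      by rewrite mulr_ge0 ?(ltW e0)//; lra.
    by rewrite mulNr -mulrN mulr_ge0 ?(ltW e0)//; lra.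
apply: le_trans (measureU2 _ (mEv e) (mEv (- e))) _.
rewrite mulr_natl mulr2n EFinD; apply: leeD.
  apply: le_trans (energy_tail B0 _) _; first lra.
  rewrite lee_fin ler_expR -mulrN ler_wpM2l ?divr_ge0//.
  by have := @ln_cubic_ub R e; lra.
apply: le_trans (energy_tail B0 _) _; first lra.
rewrite lee_fin ler_expR -mulrN ler_wpM2l ?divr_ge0//.
have := @ln_cubic_ub R (- e); have : 0 <= e ^+ 3 by rewrite exprn_ge0// ltW.
rewrite exprNn sqrrN; lra.
Qed.

End energy.

(** * Union bound and numerical estimates *)

Lemma measurable_exists2 d (T : measurableType d) (J : finType) (p : pred J)
    (A : J -> set T) : (forall j, measurable (A j)) ->
  measurable [set w | exists2 j, p j & A j w].
Proof.
move=> mA; rewrite (_ : [set w | _] = \bigcup_(j in [set` p]) A j)//.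
exact: fin_bigcup_measurable.
Qed.

Lemma union_bound d (T : measurableType d) (R : realType) (P : probability T R)
    (J : finType) (p : pred J) (A : J -> set T) (e : R) :
  (forall j, measurable (A j)) ->
  (forall j, p j -> (P (A j) <= e%:E)%E) ->
  (P [set w | exists2 j, p j & A j w] <= (#|p|%:R * e)%:E)%E.
Proof.
move=> mA PA.
have -> : [set w | exists2 j, p j & A j w] = \big[setU/set0]_(j <- enum p) A j.
  rewrite -bigcup_seq; apply/seteqP; split => w /= [j pj Aj]; exists j => //.
    by rewrite /= mem_enum.
  by move: pj; rewrite /= mem_enum.
rewrite cardE; have : {subset enum p <= p} by move=> j; rewrite mem_enum.
elim: (enum p) => [_|j s IH sub]; first by rewrite big_nil measure0 mul0r.
rewrite big_cons.
have ms : measurable (\big[setU/set0]_(k <- s) A k).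
  exact: bigsetU_measurable.
apply: le_trans (measureU2 _ (mA j) ms) _.
have -> : (size (j :: s))%:R * e = e + (size s)%:R * e.
  by rewrite /= -natr1; ring.
rewrite EFinD; apply: leeD; first by apply: PA; apply: sub; rewrite inE eqxx.
by apply: IH => k ks; apply: sub; rewrite inE ks orbT.
Qed.

(** From ln (1 - 1/2) <= - 1/2. *)
Lemma half_le_ln2 (R : realType) : 1 / 2 <= ln 2 :> R.
Proof.
have h : -1 < - (1 / 2) :> R by lra.
have := le_ln1Dx h; have -> : 1 + - (1 / 2) = 2^-1 :> R by field.
rewrite lnV ?posrE//; lra.
Qed.

Definition flat_theta (R : realType) (delta L : R) : R :=
  (1 - 1 / 100) * delta / (2 * 75 * L).

Lemma flat_theta_bounds (R : realType) (delta L : R) :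
  0 < delta -> delta < 1 -> 1 / 2 <= L ->
  [/\ 0 < flat_theta delta L, flat_theta delta L <= 33 / 2500 &
     flat_theta delta L * L = 33 / 5000 * delta].
Proof.
move=> d0 d1 L2; have L0 : 0 < L by lra.
split.
- by rewrite /flat_theta divr_gt0//; lra.
- by rewrite /flat_theta ler_pdivrMr; lra.
- by rewrite /flat_theta; field; rewrite gt_eqF.
Qed.

(** For such [e] the cubic term is less than a proportion 9 / 1000 of the quadratic
    one, as 2 / 3 * 33 / 2500 < 9 / 1000. *)
Lemma exponent_ge (R : realType) (M e c : R) :
  0 <= e -> e <= 33 / 2500 -> 0 <= M -> c <= M * e ^+ 2 ->
  991 / 4000 * c <= M / 2 * (e ^+ 2 / 2 - e ^+ 3 / 3).
Proof.
move=> e0 e1 M0 ce.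
have -> : M / 2 * (e ^+ 2 / 2 - e ^+ 3 / 3) = M * e ^+ 2 * (1 - 2 / 3 * e) / 4.
  by field.
have Me : 0 <= M * e ^+ 2 by rewrite mulr_ge0 ?sqr_ge0.
have : M * e ^+ 2 * (991 / 1000) <= M * e ^+ 2 * (1 - 2 / 3 * e).
  by rewrite ler_wpM2l//; lra.
lra.
Qed.

Lemma sample_size_le (R : realType) (delta k L l M : R) : 0 < delta ->
  33 * 75 ^+ 2 / delta ^+ 2 * k * L ^+ 2 * l <= M ->
  33 * 75 ^+ 2 * (k * L ^+ 2 * l) <= M * delta ^+ 2.
Proof.
move=> d0 h; rewrite -ler_pdivrMr ?exprn_gt0//; apply: le_trans h.
by rewrite le_eqVlt; apply/orP; left; apply/eqP; field; rewrite gt_eqF.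
Qed.

(** This is where 33 is needed: 33 * 0.99^2 / 4 * 0.991 / 4 is about 2.003, and
    2 K log N is the logarithm of the number of pairs of small sets. *)
Lemma flat_exponent (R : realType) (delta k L l M : R) :
  0 < delta -> delta < 1 -> 0 <= k -> 1 / 2 <= L -> 0 <= l -> 0 <= M ->
  33 * 75 ^+ 2 * (k * L ^+ 2 * l) <= M * delta ^+ 2 ->
  (2 + 1 / 500) * (k * l) <=
    M / 2 * (flat_theta delta L ^+ 2 / 2 - flat_theta delta L ^+ 3 / 3).
Proof.
move=> d0 d1 k0 L2 l0 M0 hM.
have [t0 t1 tL] := flat_theta_bounds d0 d1 L2.
have L0 : 0 < L by lra.
have kl0 : 0 <= k * l by rewrite mulr_ge0.
have cM : 33 * (99 / 100) ^+ 2 / 4 * (k * l) <= M * flat_theta delta L ^+ 2.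
  rewrite -(@ler_pM2r _ (L ^+ 2)) ?exprn_gt0// -[leRHS]mulrA -exprMn tL.
  rewrite exprMn; lra.
apply: le_trans (exponent_ge (ltW t0) t1 M0 cM); lra.
Qed.

(** There are only N columns, so that any exponent above log N by a fixed
    proportion is enough. *)
Lemma column_exponent (R : realType) (delta k L l M : R) :
  0 < delta -> delta < 1 -> 2 <= k -> 1 / 2 <= L -> 0 <= l -> 0 <= M ->
  33 * 75 ^+ 2 * (k * L ^+ 2 * l) <= M * delta ^+ 2 ->
  (1 + 1 / 250) * l <=
    M / 2 * ((delta / 100) ^+ 2 / 2 - (delta / 100) ^+ 3 / 3).
Proof.
move=> d0 d1 k2 L2 l0 M0 hM.
have e0 : 0 <= delta / 100 by lra.
have e1 : delta / 100 <= 33 / 2500 by lra.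
have L4 : 1 / 4 <= L ^+ 2 by nra.
have kL : 1 / 2 <= k * L ^+ 2 by nra.
have kLl : 1 / 2 * l <= k * L ^+ 2 * l by rewrite ler_wpM2r.
have cM : 297 / 32 * l <= M * (delta / 100) ^+ 2.
  rewrite expr_div_n; lra.
apply: le_trans (exponent_ge e0 e1 M0 cM); lra.
Qed.

(** As 1 + L <= 3 L, the first term is at most 24 times
    flat_theta delta L * L = 0.0066 delta. *)
Lemma RIP_constant (R : realType) (delta L H : R) :
  0 < delta -> delta < 1 -> 1 / 2 <= L -> H <= 1 + L ->
  8 * flat_theta delta L * H + 1 / 100 * delta <= delta.
Proof.
move=> d0 d1 L2 HL; have [t0 _ tL] := flat_theta_bounds d0 d1 L2.
have : flat_theta delta L * H <= flat_theta delta L * (1 + L).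
  by rewrite ler_wpM2l// ltW.
have : flat_theta delta L * 1 <= flat_theta delta L * (2 * L).
  by rewrite ler_wpM2l ?(ltW t0)//; lra.
lra.
Qed.

(** * The random matrix *)

Section random_matrix_events.
Context d (T : measurableType d) (R : realType) (P : probability T R).
Variables (m n : nat) (X : 'I_m * 'I_n -> {RV P >-> R}).

Lemma measurable_gram i j :
  measurable_fun setT (fun w => gram (random_matrix X w) i j).
Proof.
rewrite (_ : (fun w => _) = fun w => \sum_r X (r, i) w * X (r, j) w).
  by apply: measurable_sum => r; exact: measurable_funM.
by apply/funext => w; apply: eq_bigr => r _; rewrite !mxE.
Qed.

Lemma measurable_flat_RO K th :
  measurable [set w | flat_RO (random_matrix X w) K th].
Proof.
pose dt (I J : {set 'I_n}) w := dotcv (\sum_(i in I) col i (random_matrix X w))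
  (\sum_(j in J) col j (random_matrix X w)).
pose p (u : {set 'I_n} * {set 'I_n}) :=
  [&& [disjoint u.1 & u.2]%B, (#|u.1| <= K)%N & (#|u.2| <= K)%N].
pose A (u : {set 'I_n} * {set 'I_n}) : set T :=
  ~` (setT `&` [set w | `|dt u.1 u.2 w| <= th * Num.sqrt (#|u.1| * #|u.2|)%:R]).
have mdt I J : measurable_fun setT (dt I J).
  rewrite (_ : dt I J = fun w =>
      \sum_(i in I) \sum_(j in J) gram (random_matrix X w) i j).
    apply: (measurable_sum_cond (h := fun i w =>
      \sum_(j in J) gram (random_matrix X w) i j)) => i _.
    apply: (measurable_sum_cond (h := fun j w =>
      gram (random_matrix X w) i j)) => j _.
    exact: measurable_gram.
  by apply/funext => w; rewrite /dt dotcv_sums.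
rewrite (_ : [set w | _] = ~` [set w | exists2 u, p u & A u w]).
  apply: measurableC; apply: measurable_exists2 => u.
  apply: measurableC; apply: measurable_fun_le => //.
  exact: measurableT_comp.
apply/seteqP; split => [w h [[I J] /and3P[dIJ cI cJ]]|w /= h I J dIJ cI cJ].
  by apply; split => //; exact: h.
apply: contrapT => hn; apply: h; exists (I, J); first by rewrite /p /= dIJ cI.
by move=> [_].
Qed.

Lemma measurable_columns c :
  measurable [set w | forall j, `|gram (random_matrix X w) j j - 1| <= c].
Proof.
pose A j : set T :=
  ~` (setT `&` [set w | `|gram (random_matrix X w) j j - 1| <= c]).
rewrite (_ : [set w | _] = ~` [set w | exists2 j, predT j & A j w]).
  apply: measurableC; apply: measurable_exists2 => j.
  apply: measurableC; apply: measurable_fun_le => //.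
  apply: measurableT_comp => //.
  by apply: measurable_funB => //; exact: measurable_gram.
apply/seteqP; split => [w h [j _]|w /= h j].
  by apply; split => //; exact: h.
by apply: contrapT => hn; apply: h; exists j => // -[_].
Qed.

Lemma energy_mx b w : energy X b w = mx_energy (random_matrix X w) b.
Proof.
rewrite /energy /mx_energy; apply: eq_bigr => r _; congr (_ ^+ 2).
by apply: eq_bigr => j _; rewrite mxE.
Qed.

Hypothesis m0 : (0 < m)%N.
Hypothesis indepX : mutually_independent X.
Hypothesis gaussX : forall ij, gaussian_rv (X ij) 0 (1 / m%:R).

(** Two energies for each pair of small sets and one energy for each column have
    to concentrate; the union bound collects the exceptional events. *)
Lemma flat_columns_probability K (th a : R) :
  0 < th -> th < 1 -> 0 < a -> a < 1 ->
  ((1 - ((n ^ K * n ^ K * 2)%:R * chi2_tail m th + n%:R * chi2_tail m a))%:E <=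
   P [set w | flat_RO (random_matrix X w) K th /\
     forall j, (`|gram (random_matrix X w) j j - 1| <= a)%R])%E.
Proof.
move=> th0 th1 a0 a1.
pose p (u : {set 'I_n} * {set 'I_n} * bool) :=
  [&& [disjoint u.1.1 & u.1.2]%B, (0 < #|u.1.1| <= K)%N & (0 < #|u.1.2| <= K)%N].
pose B (u : {set 'I_n} * {set 'I_n} * bool) : R := \sum_j polar R u j ^+ 2.
pose A1 u : set T := [set w | th * B u < `|energy X (polar R u) w - B u|].
pose e_ (j : 'I_n) (k : 'I_n) : R := (k == j)%:R.
have eB j : \sum_k e_ j k ^+ 2 = 1.
  rewrite (bigD1 j)//= /e_ eqxx expr1n big1 ?addr0// => k /negbTE ->.
  by rewrite expr0n.
pose A2 j : set T := [set w | a * \sum_k e_ j k ^+ 2 <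
  `|energy X (e_ j) w - \sum_k e_ j k ^+ 2|].
have mA1 u : measurable (A1 u) by exact: measurable_energy_dev.
have mA2 j : measurable (A2 j) by exact: measurable_energy_dev.
pose U1 := [set w | exists2 u, p u & A1 u w].
pose U2 := [set w | exists2 j, predT j & A2 j w].
have mU1 : measurable U1 by exact: measurable_exists2.
have mU2 : measurable U2 by exact: measurable_exists2.
have f0 (e : R) : 0 <= chi2_tail m e by rewrite mulr_ge0 ?expR_ge0.
have PU1 : (P U1 <= ((n ^ K * n ^ K * 2)%:R * chi2_tail m th)%:E)%E.
  apply: le_trans (@union_bound _ T R P _ p A1 (chi2_tail m th) mA1 _) _.
    move=> [[I J] s] /and3P[/= dIJ /andP[I0 _] /andP[J0 _]].
    apply: energy_concentration => //.
    by rewrite sum_sqr_polar// !mulr_gt0 ?ltr0n.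
  rewrite lee_fin ler_wpM2r// ler_nat.
  pose S := [set I : {set 'I_n} | (0 < #|I| <= K)%N]%SET.
  have cS : (#|S| <= n ^ K)%N by rewrite -[X in (_ <= X ^ K)%N]card_ord card_small_sets.
  apply: (@leq_trans #|finset.setX (finset.setX S S) [set: bool]%SET|); last first.
    by rewrite !cardsX cardsT card_bool leq_mul// leq_mul.
  apply: subset_leq_card; apply/fintype.subsetP => -[[I J] s] /and3P[/= _ hI hJ].
  by rewrite !inE hI hJ.
have PU2 : (P U2 <= (n%:R * chi2_tail m a)%:E)%E.
  apply: le_trans (@union_bound _ T R P _ predT A2 (chi2_tail m a) mA2 _) _.
    by move=> j _; apply: energy_concentration; rewrite ?eB.
  by rewrite lee_fin cardT size_enum_ord.
apply: (@le_trans _ _ (P (~` (U1 `|` U2)))).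
  rewrite probability_setC; last exact: measurableU.
  rewrite EFinB leeB//; apply: le_trans (measureU2 _ mU1 mU2) _.
  by rewrite EFinD leeD.
apply: le_measure; rewrite ?inE.
- by apply: measurableC; exact: measurableU.
- by apply: measurableI; [exact: measurable_flat_RO|exact: measurable_columns].
move=> w /= nU; split.
  apply: flat_RO_of_energy => I J s dIJ cI cJ; rewrite -energy_mx leNgt.
  apply/negP => h; apply: nU; left; exists (I, J, s) => //.
  by rewrite /p/= dIJ cI cJ.
move=> j; rewrite leNgt; apply/negP => h; apply: nU; right; exists j => //.
by rewrite /A2/= eB mulr1 energy_mx mx_energy_delta.
Qed.

End random_matrix_events.

(** Up to a constant, each exponent exceeds the logarithm of the corresponding
    number of events by at least l / 250. *)
Lemma failure_bound (R : realType) (k n : nat) (l e1 e2 : R) : (2 <= k)%N ->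
  0 <= l -> n%:R = expR l ->
  (2 + 1 / 500) * (k%:R * l) <= e1 -> (1 + 1 / 250) * l <= e2 ->
  (n ^ k * n ^ k * 2)%:R * (2 * expR (- e1)) + n%:R * (2 * expR (- e2)) <=
  6 * expR (- (l / 250)).
Proof.
move=> k2 l0 nE h1 h2.
have kl : 2 * l <= k%:R * l by rewrite ler_wpM2r// ler_nat.
have -> : (n ^ k * n ^ k * 2)%:R * (2 * expR (- e1)) =
    4 * expR (k%:R * l + k%:R * l - e1).
  by rewrite !natrM !natrX nE -!expRM_natl !expRD; ring.
have -> : n%:R * (2 * expR (- e2)) = 2 * expR (l - e2) by rewrite nE expRD; ring.
have : expR (k%:R * l + k%:R * l - e1) <= expR (- (l / 250)).
  by rewrite ler_expR; lra.
have : expR (l - e2) <= expR (- (l / 250)) by rewrite ler_expR; lra.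
lra.
Qed.

Theorem theorem31 (R : realType) :
  let C : R := 75 in
  let alpha : R := 1 / 100 in
  forall eta : R, 0 < eta ->
  exists N0 : nat, forall N : nat, (N0 <= N)%N ->
  forall delta : R, 0 < delta -> delta < 1 ->
  forall K : nat, (2 <= K)%N -> (K <= N)%N ->
  forall M : nat, (1 <= M)%N ->
  33 * C ^+ 2 / delta ^+ 2 * K%:R * ln (K%:R : R) ^+ 2 * ln (N%:R : R)
    <= M%:R ->
  forall (d : measure_display) (T : measurableType d) (P : probability T R)
    (X : 'I_M * 'I_N -> {RV P >-> R}),
  mutually_independent X ->
  (forall ij, gaussian_rv (X ij) 0 (1 / M%:R)) ->
  ((1 - eta)%:E <=
    P [set w | let Phi := random_matrix X w in
        [/\ flat_RO Phi K ((1 - alpha) * delta / (2 * C * ln (K%:R : R))),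
            (RIC Phi 1 <= alpha * delta)%R
          & RIP Phi (2 * K) delta]])%E.
Proof.
move=> C alpha eta eta0.
(* From this rank on, 6 N^(- 1 / 250) is at most eta. *)
exists (Num.bound (expR (250 * ln (6 / eta)))) => N N0N delta d0 d1 K K2 KN M M1.
rewrite /C /alpha => hM d T P X indepX gaussX.
set L := ln (K%:R : R) in hM *; set l := ln (N%:R : R) in hM.
have N2 : (2 <= N)%N by exact: leq_trans KN.
have Npos : 0 < N%:R :> R by rewrite ltr0n (leq_trans _ N2).
have NE : N%:R = expR l by rewrite lnK// posrE.
have l0 : 0 <= l by rewrite ln_ge0// ler1n (leq_trans _ N2).
have L2 : 1 / 2 <= L.
  apply: le_trans (half_le_ln2 R) _; rewrite ler_ln ?posrE ?ltr0n ?ler_nat//.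
  exact: leq_trans K2.
have k2 : 2 <= K%:R :> R by rewrite ler_nat.
have [t0 t1 _] := flat_theta_bounds d0 d1 L2.
have th1 : flat_theta delta L < 1 by lra.
have a0 : 0 < delta / 100 by lra.
have a1 : delta / 100 < 1 by lra.
have {}hM := sample_size_le d0 hM.
have aE : 1 / 100 * delta = delta / 100 by ring.
(* The restricted isometry property is implied by the other two conditions, and
   what remains is visibly measurable. *)
have -> : [set w | let Phi := random_matrix X w in
    [/\ flat_RO Phi K ((1 - 1 / 100) * delta / (2 * 75 * L)),
        (RIC Phi 1 <= 1 / 100 * delta)%R & RIP Phi (2 * K) delta]] =
    [set w | flat_RO (random_matrix X w) K (flat_theta delta L) /\
      forall j, `|gram (random_matrix X w) j j - 1| <= delta / 100].
  have N1 : (0 < N)%N by exact: leq_trans N2.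
  apply/seteqP; split => w /=.
    by move=> [hf /(RIC1_le _ _ N1)]; rewrite aE.
  move=> [hf hc]; split => //; first by apply/RIC1_le => //; rewrite aE.
  have hr := flat_RO_RIP (ltW t0) hf hc.
  move=> x /hr /andP[h1 h2].
  have HL : harmonic_number R K <= 1 + L.
    by apply: harmonic_number_le_ln; exact: leq_trans K2.
  have cd := RIP_constant d0 d1 L2 HL; rewrite aE in cd.
  have x0 : 0 <= l2norm x ^+ 2 by exact: sqr_ge0.
  apply/andP; split.
    by apply: le_trans h1; rewrite ler_wpM2r// lerD2l lerN2.
  by apply: le_trans h2 _; rewrite ler_wpM2r// lerD2l.
apply: le_trans (flat_columns_probability M1 indepX gaussX K t0 th1 a0 a1).
rewrite lee_fin lerD2l lerN2.
apply: le_trans (failure_bound K2 l0 NE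
  (flat_exponent d0 d1 (ler0n _ _) L2 l0 (ler0n _ _) hM)
  (column_exponent d0 d1 k2 L2 l0 (ler0n _ _) hM)) _.
have e6 : 0 < 6 / eta by rewrite divr_gt0.
have Nbig : 250 * ln (6 / eta) <= l.
  rewrite -ler_expR -NE; apply: ltW; apply: lt_le_trans (archi_boundP (expR_ge0 _)) _.
  by rewrite ler_nat.
apply: (@le_trans _ _ (6 * expR (- ln (6 / eta)))).
  by rewrite ler_wpM2l// ler_expR; lra.
rewrite expRN lnK ?posrE// invf_div mulrC divfK//.
Qed.
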